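(* Let $X$ be a zero-dimensional compact metric space and let $K$ be $H(X)$ or any subgroup of $H(X)$. Let $D^*$ be any extended district in $K$. If $D^*$ contains an element $\tau$ with $(X,\tau)$ topologically conjugate to a mixing SFT, then for every expansive element $\varphi$ in $D^*$ the following hold: (1) $(X,\varphi)$ is topologically conjugate to a mixing SFT; (2) all left $\varphi$-expansive elements in $PL_K(\varphi)$ and all right $\varphi$-expansive elements in $QR_K(\varphi)$ have POTP and are topologically mixing; (3) all elements in $C_K(\varphi)$ have POTP.
   Context: **Basics.** $H(X)$ is the group of homeomorphisms of $X$; $d_X$ is the metric. A homeomorphism $\tau$ of $X$ is expansive if there is $\delta>0$ such that $d_X(\tau^j(x),\tau^j(y))\le\delta$ for all $j\in\mathbb Z$ implies $x=y$. An automorphism of $(X,\tau)$ is a homeomorphism of $X$ commuting with $\tau$. For commuting homeomorphisms $\psi,\tau$, $\psi$ is left (resp. right) $\tau$-expansive if there is $\delta>0$ such that $d_X(\tau^j\psi^i(x),\tau^j\psi^i(y))\le\delta$ for all $i\in\mathbb Z$ and all $j\le0$ (resp. $j\ge0$) implies $x=y$. A homeomorphism $\psi$ has the pseudo orbit tracing property (POTP) if for every $\epsilon>0$ there is $\delta>0$ such that for every bisequence $(x_i')_{i\in\mathbb Z}$ with $d_X(\psi(x_i'),x_{i+1}')\le\delta$ for all $i$ there is an orbit $(x_i)$ of $\psi$ with $d_X(x_i,x_i')<\epsilon$ for all $i$. A subshift $(X',\sigma')$ over a finite alphabet $A$ is a closed $X'\subset A^{\mathbb Z}$ with $\sigma'(X')=X'$,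 $\sigma'$ being the shift $(a_j)\mapsto(a_{j+1})$. SFT means subshift of finite type; a mixing SFT is one that is topologically mixing. **Resolving automorphisms.** A graph is a finite directed graph $G$ (multiple arcs, loops allowed) with arc-set $A_G$, vertex-set $V_G$ and initial/terminal vertex maps $i_G,t_G$; $X_G\subset A_G^{\mathbb Z}$ is the set of bi-infinite paths. A graph-homomorphism $h=(h_A,h_V):\Gamma\to G$ is a pair of maps on arcs and vertices compatible with $i,t$; it induces $\phi_h:X_\Gamma\to X_G$, $(\alpha_j)\mapsto(h_A(\alpha_j))$. $h$ is weakly left-resolving (resp. weakly right-resolving) if every arc $\alpha$ of $\Gamma$ is uniquely determined by $t_\Gamma(\alpha)$ (resp. $i_\Gamma(\alpha)$) and $h_A(\alpha)$. A textile system is a pair $(p,q:\Gamma\to G)$ of graph-homomorphisms; it is weakly $p$-L if $p$ is weakly left-resolving, weakly $q$-R if $q$ is weakly right-resolving, weakly LR if both. For $\mathcal P\in\{p\text{-L},q\text{-R},\text{LR}\}$, a continuous shift-commuting map $\varphi':X'\to X'$ of a subshift is weakly $\mathcal P$ if there are a weakly $\mathcal P$ textile system $(p,q:\Gamma\to G)$ and a closed shift-invariant $Z\subset X_\Gamma$ such that $\phi_p|_Z$ is injective, $\phi_p(Z)=X'$, $\phi_q(Z)\subset X'$ and $\varphi'=\phi_q\circ(\phi_p|_Z)^{-1}$. An automorphism $\psi$ of $(X,\tau)$ is essentially weakly $\mathcal P$ if there are a subshift $(X',\sigma')$, a weakly $\mathcal P$ endomorphism $\varphi'$ of it and a homeomorphism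 $\theta:X\to X'$ with $\theta\tau=\sigma'\theta$, $\theta\psi=\varphi'\theta$. **Districts.** For an expansive $\tau\in K$, $PL_K(\tau)$, $QR_K(\tau)$ and $C_K(\tau)$ are the sets of $\psi\in K$ that are, respectively, essentially weakly $p$-L, essentially weakly $q$-R and essentially weakly LR automorphisms of $(X,\tau)$. Write $\psi\multimap\tau$ if $\tau$ is expansive and $\psi$ is an essentially weakly $p$-L or an essentially weakly $q$-R automorphism of $(X,\tau)$. For an expansive $\tau\in K$, the extended district $D_K^*(\tau)$ of $\tau$ in $K$ is the set of $\psi\in K$ for which there are $r\ge1$ and expansive elements $\tau_1,\dots,\tau_r\in K$ with $\psi\multimap\tau_1,\ \tau_1\multimap\tau_2,\dots,\tau_{r-1}\multimap\tau_r=\tau$. An extended district in $K$ is a set $D_K^*(\tau)$ with $\tau\in K$ expansive. *)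

(* Defs.v *)
From HB Require Import structures.
From mathcomp Require Import all_boot all_order all_algebra.
From mathcomp Require Import all_classical reals topology.

Set Implicit Arguments.
Unset Strict Implicit.
Unset Printing Implicit Defensive.

Import Order.TTheory GRing.Theory Num.Theory.
Local Open Scope classical_set_scope.
Local Open Scope ring_scope.

Record homeomorphism (X Y : topologicalType) := Homeomorphism {
  homeo_fun :> X -> Y;
  homeo_inv : Y -> X;
  homeo_funK : cancel homeo_fun homeo_inv;
  homeo_invK : cancel homeo_inv homeo_fun;
  homeo_fun_continuous : continuous homeo_fun;
  homeo_inv_continuous : continuous homeo_inv
}.

(* The group H(X); the product is composition, (f * g) x = f (g x). *)
Definition homeo (X : topologicalType) := homeomorphism X X.

Section HomeoGroup.
Variable X : topologicalType.

Lemma homeo_ext (f g : homeo X) : (forall x, f x = g x) -> f = g.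
Proof.
move=> fg; have gf : homeo_inv f = homeo_inv g.
  by apply/funext => x; rewrite -{1}(homeo_invK g x) -fg homeo_funK.
have {}fg : homeo_fun f = homeo_fun g by exact/funext.
case: f g fg gf => [f f' fK f'K cf cf'] [g g' gK g'K cg cg'] /= fg gf.
subst g g'; congr Homeomorphism; exact: Prop_irrelevance.
Qed.

Definition homeo_one : homeo X :=
  @Homeomorphism X X id id (fun=> erefl) (fun=> erefl)
    (fun x => @cvg_id _ _) (fun x => @cvg_id _ _).

Definition homeo_invg (f : homeo X) : homeo X :=
  Homeomorphism (homeo_invK f) (homeo_funK f)
    (@homeo_inv_continuous _ _ f) (@homeo_fun_continuous _ _ f).

Lemma homeo_comp_continuous (f g : X -> X) :
  continuous f -> continuous g -> continuous (f \o g).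
Proof. by move=> cf cg x; apply: continuous_comp; [exact: cg|exact: cf]. Qed.

Definition homeo_mul (f g : homeo X) : homeo X :=
  Homeomorphism (can_comp (homeo_funK f) (homeo_funK g))
    (can_comp (homeo_invK g) (homeo_invK f))
    (homeo_comp_continuous (@homeo_fun_continuous _ _ f)
                           (@homeo_fun_continuous _ _ g))
    (homeo_comp_continuous (@homeo_inv_continuous _ _ g)
                           (@homeo_inv_continuous _ _ f)).

HB.instance Definition _ := gen_eqMixin (homeo X).
HB.instance Definition _ := gen_choiceMixin (homeo X).

Lemma homeo_mulA : associative homeo_mul.
Proof. by move=> f g h; exact: homeo_ext. Qed.

Lemma homeo_1mul : left_id homeo_one homeo_mul.
Proof. by move=> f; exact: homeo_ext. Qed.

Lemma homeo_mul1 : right_id homeo_one homeo_mul.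
Proof. by move=> f; exact: homeo_ext. Qed.

Lemma homeo_Vmul : left_inverse homeo_one homeo_invg homeo_mul.
Proof. by move=> f; apply: homeo_ext => x; exact: homeo_funK. Qed.

Lemma homeo_mulV : right_inverse homeo_one homeo_invg homeo_mul.
Proof. by move=> f; apply: homeo_ext => x; exact: homeo_invK. Qed.

HB.instance Definition _ := isGroup.Build (homeo X)
  homeo_mulA homeo_1mul homeo_mul1 homeo_Vmul homeo_mulV.

Definition homeo_exp (f : homeo X) (j : int) : homeo X :=
  match j with
  | Posz n => (f ^+ n)%g
  | Negz n => (f ^- n.+1)%g
  end.

End HomeoGroup.

Section TopologicalDynamics.

Definition topologically_mixing (T : topologicalType) (f : T -> T) :=
  forall U V : set T, open U -> open V -> U !=set0 -> V !=set0 ->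
    exists N : nat, forall n, (N <= n)%N -> (iter n f @` U) `&` V !=set0.

Definition conjugate (X Y : topologicalType) (f : X -> X) (g : Y -> Y) :=
  exists theta : homeomorphism X Y, forall x, theta (f x) = g (theta x).

End TopologicalDynamics.

Section MetricDynamics.
Variables (R : realType) (X : metricType R).
Implicit Types tau psi : homeo X.

Definition expansive tau := exists2 delta : R, 0 < delta &
  forall x y : X,
    (forall j : int, mdist (homeo_exp tau j x) (homeo_exp tau j y) <= delta) ->
  x = y.

Definition left_expansive tau psi := exists2 delta : R, 0 < delta &
  forall x y : X,
    (forall i j : int, j <= 0 ->
       mdist (homeo_exp tau j (homeo_exp psi i x))
             (homeo_exp tau j (homeo_exp psi i y)) <= delta) ->
  x = y.

Definition right_expansive tau psi := exists2 delta : R, 0 < delta &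
  forall x y : X,
    (forall i j : int, 0 <= j ->
       mdist (homeo_exp tau j (homeo_exp psi i x))
             (homeo_exp tau j (homeo_exp psi i y)) <= delta) ->
  x = y.

Definition POTP psi := forall eps : R, 0 < eps ->
  exists2 delta : R, 0 < delta &
  forall x' : int -> X,
    (forall i, mdist (psi (x' i)) (x' (i + 1)) <= delta) ->
  exists2 x : int -> X, (forall i, x (i + 1) = psi (x i)) &
    forall i, mdist (x i) (x' i) < eps.

End MetricDynamics.

Notation fullshift A := {ptws int -> discrete_topology A}.

Section Subshifts.

Definition shift (A : finType) (a : fullshift A) : fullshift A :=
  fun j : int => a (j + 1).

Record subshift (A : finType) := Subshift {
  subshift_set :> set (fullshift A);
  subshift_closed : closed subshift_set;
  subshift_shift : @shift A @` subshift_set = subshift_set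
}.

Lemma mem_shift (A : finType) (S : subshift A) (a : fullshift A) :
  a \in (S : set _) -> shift a \in (S : set _).
Proof. by rewrite !inE => Sa; rewrite -[X in X _]subshift_shift; exists a. Qed.

Definition sigma (A : finType) (S : subshift A) : S -> S :=
  fun a => exist _ (shift (val a)) (mem_shift (valP a)).

Definition occurs (A : finType) (w : seq A) (a : fullshift A) :=
  exists i : int, forall k : 'I_(size w), tnth (in_tuple w) k = a (i + k%:Z).

Definition finite_type (A : finType) (S : subshift A) :=
  exists F : seq (seq A),
    (S : set _) = [set a | forall w, w \in F -> ~ occurs w a].

Definition mixing_SFT (A : finType) (S : subshift A) :=
  finite_type S /\ topologically_mixing (@sigma A S).

Definition conjugate_to_mixing_SFT (X : topologicalType) (f : X -> X) :=
  exists (A : finType) (S : subshift A),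
    mixing_SFT S /\ conjugate f (@sigma A S).

End Subshifts.

Section TextileSystems.

(* The arc-set is a parameter, as it is the alphabet of the path space. *)
Record graph (A : finType) := Graph {
  vertex : finType;
  initial : A -> vertex;
  terminal : A -> vertex
}.

Definition path_space (A : finType) (G : graph A) : set (fullshift A) :=
  [set a | forall j : int, terminal G (a j) = initial G (a (j + 1))].

Record graph_hom (B A : finType) (Gamma : graph B) (G : graph A) := GraphHom {
  hom_arc : B -> A;
  hom_vertex : vertex Gamma -> vertex G;
  hom_initial : forall b, initial G (hom_arc b) = hom_vertex (initial Gamma b);
  hom_terminal :
    forall b, terminal G (hom_arc b) = hom_vertex (terminal Gamma b)
}.

Definition bipath_map (B A : finType) (Gamma : graph B) (G : graph A)
    (h : graph_hom Gamma G) (a : fullshift B) : fullshift A :=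
  fun j : int => hom_arc h (a j).

Definition weakly_left_resolving (B A : finType) (Gamma : graph B)
    (G : graph A) (h : graph_hom Gamma G) :=
  forall a b : B,
    terminal Gamma a = terminal Gamma b -> hom_arc h a = hom_arc h b -> a = b.

Definition weakly_right_resolving (B A : finType) (Gamma : graph B)
    (G : graph A) (h : graph_hom Gamma G) :=
  forall a b : B,
    initial Gamma a = initial Gamma b -> hom_arc h a = hom_arc h b -> a = b.

Inductive resolving_kind := pL | qR | LR.

Definition weakly_textile (P : resolving_kind) (B A : finType)
    (Gamma : graph B) (G : graph A) (p q : graph_hom Gamma G) : Prop :=
  match P with
  | pL => weakly_left_resolving p
  | qR => weakly_right_resolving q
  | LR => weakly_left_resolving p /\ weakly_right_resolving q
  end.

(* Since bipath_map p maps Z onto S, the symbols of S are arcs of G; the alphabet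
   of S is taken to be the whole arc-set of G. *)
Definition weakly (P : resolving_kind) (A : finType) (S : subshift A)
    (f : S -> S) :=
  [/\ continuous f, (forall a, f (sigma a) = sigma (f a)) &
   exists (B : finType) (Gamma : graph B) (G : graph A)
          (p q : graph_hom Gamma G) (Z : subshift B),
     [/\ weakly_textile P p q,
         Z `<=` path_space Gamma /\ set_inj Z (bipath_map p),
         bipath_map p @` Z = S,
         bipath_map q @` Z `<=` S &
         forall (a : S) (z : fullshift B),
           subshift_set Z z -> bipath_map p z = val a -> val (f a) = bipath_map q z]].

Definition essentially_weakly (P : resolving_kind) (X : topologicalType)
    (tau psi : homeo X) :=
  commute psi tau /\
  exists (A : finType) (S : subshift A) (f : S -> S) (theta : homeomorphism X S),
    [/\ weakly P f,
        (forall x, theta (tau x) = sigma (theta x)) &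
        (forall x, theta (psi x) = f (theta x))].

End TextileSystems.

Section Districts.
Variables (R : realType) (X : metricType R) (K : set (homeo X)).

Definition PL (tau : homeo X) : set (homeo X) :=
  [set psi | K psi /\ essentially_weakly pL tau psi].

Definition QR (tau : homeo X) : set (homeo X) :=
  [set psi | K psi /\ essentially_weakly qR tau psi].

Definition CLR (tau : homeo X) : set (homeo X) :=
  [set psi | K psi /\ essentially_weakly LR tau psi].

(* The relation "psi -o tau". *)
Definition resolves (psi tau : homeo X) :=
  expansive tau /\
  (essentially_weakly pL tau psi \/ essentially_weakly qR tau psi).

Definition extended_district_of (tau : homeo X) : set (homeo X) :=
  [set psi | K psi /\
     exists (r : nat) (t : nat -> homeo X),
       [/\ (1 <= r)%N,
           (forall i, (1 <= i <= r)%N -> K (t i) /\ expansive (t i)),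
           resolves psi (t 1%N),
           (forall i, (1 <= i < r)%N -> resolves (t i) (t i.+1)) &
           t r = tau]].

Definition extended_district (D : set (homeo X)) :=
  exists tau : homeo X,
    [/\ K tau, expansive tau & D = extended_district_of tau].

End Districts.

(* Main.v *)
(* An essentially weakly p-L automorphism psi of (X, tau) has no memory in suitable
   symbolic coordinates P for tau: finitely many letters P(x), P(tau x), P(tau^2 x),
   ... determine P(psi x). The q-R case is the p-L case for (tau^-1, psi^-1).

   Let tau be a mixing SFT and psi a left tau-expansive memoryless automorphism.
   Consider the array P(tau^c psi^a x), and let W be the Markov approximation of
   psi on windows of k columns: the sequences of windows whose transitions occur in
   X. A path of W can always be extended to the left by columns, since the SFT tau
   glues a prefix to its bottom row and memorylessness forces the rest. By left
   expansiveness an extended path is determined, up to its ends, by its k leftmost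
   columns. Hence, up to a constant factor, at least as many paths of W extend to the
   right by m columns as there are paths of W. Since a language missing some path out
   of every vertex grows exponentially slower than W, some component of W consists
   of paths extending arbitrarily far to the right, and these are traced by points
   of X. Such components form a clopen tau-invariant set, which is X because tau is
   mixing. So the windows are Markov partitions for psi, whence POTP; mixing follows
   because tau permutes the classes of windows modulo paths of length divisible by p.

   If psi is also expansive, the roles can be exchanged: a vertical ray of a thick
   column determines the column on its left, by expansiveness below and by
   memorylessness upwards, so tau^-1 is memoryless over psi^-1. Therefore being a
   mixing SFT passes both ways along the chains defining the extended district. In
   the LR case pseudo-orbits can be traced directly, by gluing rows upwards. *)

Require Import Defs.
From HB Require Import structures.
From mathcomp Require Import all_boot all_order all_algebra zify lra.
From mathcomp Require Import all_classical reals topology.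

Set Implicit Arguments.
Unset Strict Implicit.
Unset Printing Implicit Defensive.

(** * Counting paths in a finite graph *)

Section Walks.
Local Open Scope nat_scope.
Variables (B : finType) (E : rel B).

Definition walks (n : nat) (b : B) := #|[set s : n.-tuple B | path E b s]|.

Lemma card_cat_tuple (m n : nat) (Q : pred (seq B)) :
  #|[set s : (m + n).-tuple B | Q s]| =
  \sum_(s : m.-tuple B) #|[set t : n.-tuple B | Q (s ++ t)]|.
Proof.
rewrite -sum1dep_card.
under [RHS]eq_bigr => s _ do rewrite -sum1dep_card.
rewrite pair_big_dep /=.
pose split (s : (m + n).-tuple B) := ([tuple tnth s (lshift n i) | i < m],
  [tuple tnth s (rshift m i) | i < n]).
rewrite (reindex (fun p : m.-tuple B * n.-tuple B => cat_tuple p.1 p.2)) //=.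
exists split => [[s t] _|s _] /=.
  by congr pair; apply: eq_from_tnth => i; rewrite tnth_mktuple (tnth_lshift, tnth_rshift).
apply: eq_from_tnth => i; case: (splitP i) => j ij.
  have -> : i = lshift n j by apply: val_inj.
  by rewrite tnth_lshift tnth_mktuple.
have -> : i = rshift m j by apply: val_inj.
by rewrite tnth_rshift tnth_mktuple.
Qed.

Lemma walks_cat (m n : nat) (b : B) :
  walks (m + n) b = \sum_(s : m.-tuple B | path E b s) walks n (last b s).
Proof.
rewrite /walks (card_cat_tuple _ _ (path E b)) [RHS]big_mkcond /=.
apply: eq_bigr => s _; rewrite -sum1dep_card.
under eq_bigl => t do rewrite cat_path.
by case: ifP => _; [rewrite sum1dep_card|rewrite big_pred0].
Qed.

Lemma walks_le (n : nat) (b : B) : walks n b <= #|B| ^ n.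
Proof. by rewrite -card_tuple; exact: max_card. Qed.

Lemma walks_add_le (m n : nat) (b : B) :
  walks (m + n) b <= walks m b * #|B| ^ n.
Proof.
rewrite walks_cat /walks -sum1dep_card big_distrl /=.
by apply: leq_sum => s _; rewrite mul1n walks_le.
Qed.

Lemma walks_last (m n : nat) (b : B) (s : m.-tuple B) :
  path E b s -> walks n (last b s) <= walks (m + n) b.
Proof. by move=> Es; rewrite walks_cat (bigD1 s) //= leq_addr. Qed.

(** Every edge lies on a cycle, so the graph splits into strongly connected components, within which
    the numbers of walks from two vertices are comparable. *)
Hypothesis E_back : forall b b', E b b' -> connect E b' b.

Lemma path_back (b : B) (s : seq B) : path E b s -> connect E (last b s) b.
Proof.
elim: s b => [|c s IH] b //= /andP[Ebc /IH sc].
exact: connect_trans sc (E_back Ebc).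
Qed.

(** Prepend a simple path from [b'] to [b], which has at most [#|B|] edges, and bound the choices of
    the surplus final letters by a power of [#|B|]. *)
Lemma walks_connect (n : nat) (b b' : B) :
  connect E b' b -> walks n b <= walks n b' * #|B| ^ #|B|.
Proof.
case/connectP => p; case/shortenP => p' Ep' Up' _ ->.
have /leq_trans : walks n (last b' p') <= walks (size p' + n) b'.
  exact: (@walks_last _ _ _ (in_tuple p')).
apply; rewrite addnC (leq_trans (walks_add_le _ _ _)) // leq_mul2l.
rewrite leq_pexp2l ?orbT //; first by apply/card_gt0P; exists b'.
by rewrite ltnW // -[_.+1]/(size (b' :: p')) -(card_uniqP Up') max_card.
Qed.

Variables (Lang : pred (seq B)) (l : nat).
Hypothesis Lang_infix : forall s1 s2 s3, Lang (s1 ++ s2 ++ s3) -> Lang s2.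
Hypothesis l_gt0 : 0 < l.
Hypothesis Lang_miss : forall b b', E b b' ->
  exists s : l.-tuple B, path E b s /\ ~~ Lang (b :: s).

(** Only the successive blocks of length [l] have to lie in [Lang], not the whole word; this
    relaxation turns the count into a recursion. *)
Fixpoint block_walks (t : nat) (b : B) : nat :=
  if t is t'.+1 then
    \sum_(s : l.-tuple B | path E b s && Lang (b :: s)) block_walks t' (last b s)
  else 1.

Lemma Lang_block_walks (t : nat) (b : B) :
  #|[set s : (t * l).-tuple B | path E b s && Lang (b :: s)]| <= block_walks t b.
Proof.
elim: t b => [|t IH] b /=; first by rewrite (leq_trans (max_card _)) // card_tuple.
rewrite mulSn (card_cat_tuple _ _ (fun s => path E b s && Lang (b :: s))).
rewrite [leqRHS]big_mkcond /=; apply: leq_sum => s _.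
case: ifP => [/andP[Es Ls]|sN].
  apply: leq_trans (IH _); apply: subset_leq_card; apply/fintype.subsetP => u.
  rewrite !inE cat_path Es /= => /andP[-> /= Lu].
  move: Lu; rewrite -cat_cons lastI cat_rcons => Lu.
  by apply: (@Lang_infix (belast b s) _ [::]); rewrite cats0.
rewrite leqn0 cards_eq0; apply/eqP/setP => u; rewrite !inE.
apply: contraFF sN; rewrite cat_path => /andP[/andP[-> _] /=].
by rewrite -cat_cons => Lu; apply: (@Lang_infix [::] _ u).
Qed.

Let q := #|B| ^ l * #|B| ^ #|B|.

(** A fraction of at least [1/q] of the walks from [b] begins with the missed block [s0], because
    its end leads back to [b]. Hence each block retains a fraction of at most [(q - 1)/q]. *)
Lemma block_walks_decay (t : nat) (b : B) :
  q ^ t * block_walks t b <= q.-1 ^ t * walks (t * l) b.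
Proof.
elim: t b => [|t IH] b /=.
  rewrite !expn0 !mul1n mul0n /walks card_gt0; apply/set0Pn.
  by exists [tuple]; rewrite inE.
have [[b' Ebb']|noE] := pselect (exists b', E b b'); last first.
  rewrite big1 ?muln0 // => -[[|c s] ss] /=; first by have := l_gt0; rewrite -{1}(eqP ss).
  by case/andP=> /andP[Ebc _] _; case: noE; exists c.
have [s0 [Es0 Ls0]] := Lang_miss Ebb'.
have q_gt0 : 0 < q.
  by rewrite muln_gt0 !expn_gt0; apply/andP; split; apply/orP; left; apply/card_gt0P; exists b.
set w := walks (t.+1 * l) b.
have decay : q * \sum_(s : l.-tuple B | path E b s && Lang (b :: s))
    walks (t * l) (last b s) <= q.-1 * w.
  have wE : w = \sum_(s : l.-tuple B | path E b s && Lang (b :: s))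
      walks (t * l) (last b s) +
      \sum_(s : l.-tuple B | path E b s && ~~ Lang (b :: s))
      walks (t * l) (last b s).
    by rewrite /w mulSn walks_cat (bigID (fun s : l.-tuple B => Lang (b :: s))).
  have wle : w <= q * \sum_(s : l.-tuple B | path E b s && ~~ Lang (b :: s))
      walks (t * l) (last b s).
    rewrite (bigD1 s0) /= ?Es0 //.
    rewrite mulnDr (leq_trans _ (leq_addr _ _)) // /w mulSn addnC.
    apply: leq_trans (walks_add_le _ _ _) _.
    apply: leq_trans (leq_mul (walks_connect _ (path_back Es0)) (leqnn _)) _.
    by rewrite /q mulnAC -mulnA mulnC.
  rewrite -{1}(prednK q_gt0); nia.
rewrite expnS -mulnA expnSr -mulnA.
apply: leq_trans (leq_mul (leqnn (q.-1 ^ t)) decay).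
rewrite [leqRHS]mulnCA leq_mul2l; apply/orP; right.
rewrite !big_distrr /=; apply: leq_sum => s _; exact: IH.
Qed.

Lemma pow_dominates (K c : nat) : exists2 t, 0 < t & K * c ^ t < c.+1 ^ t.
Proof.
(* The claim is Bernoulli's inequality [(1 + 1/c)^t >= 1 + t/c] without denominators, applied with
   [t = K * c + 1]. *)
exists (K * c).+1 => //; suff: forall t, c ^ t * (c + t) <= c.+1 ^ t * c.
  move=> /(_ (K * c).+1); set x := c ^ _; set y := c.+1 ^ _ => xy.
  have y0 : 0 < y by rewrite expn_gt0.
  case: (posnP c) => [c0|c0]; last by nia.
  by rewrite /x c0 expnS mul0n muln0.
elim=> [|t IH]; first by rewrite !expn0 addn0.
rewrite !expnS; move: IH; set x := c ^ t; set y := c.+1 ^ t.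
move=> IH; apply: (@leq_trans (c * x * (c + t) + c * x)); first by nia.
have : x <= y by rewrite /x /y; case: (t) => [|t']; rewrite ?expn0 // leq_exp2r.
nia.
Qed.

Lemma walks_gt0 (n : nat) (b b' : B) : E b b' -> 0 < walks n b.
Proof.
elim: n b b' => [|n IH] b b' Ebb'.
  by rewrite /walks card_gt0; apply/set0Pn; exists [tuple]; rewrite inE.
have [c /IH b'_gt0] : exists c, E b' c.
  case/connectP: (E_back Ebb') => -[_ /= bb'|c p /= /andP[Eb'c _] _]; last by exists c.
  by exists b'; rewrite -{1}bb'.
by apply: leq_trans b'_gt0 (@walks_last 1 n b [tuple b'] _); rewrite /= Ebb'.
Qed.

(* This replaces the fact that a proper subshift of an irreducible SFT has strictly
   smaller entropy. *)
Lemma Lang_sparse (K : nat) (b b' : B) : E b b' ->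
  exists2 n, 0 < n & K * \sum_c #|[set s : n.-tuple B | path E c s && Lang (c :: s)]| <
            \sum_c walks n c.
Proof.
move=> Ebb'; have [t t_gt0 Kt] := pow_dominates K q.-1.
have q_gt0 : 0 < q.
  by rewrite muln_gt0 !expn_gt0; apply/andP; split; apply/orP; left; apply/card_gt0P; exists b.
exists (t * l); first by rewrite muln_gt0 t_gt0.
set S := \sum_c _; set W := \sum_c _.
have W_gt0 : 0 < W by rewrite /W (bigD1 b) //= addn_gt0 (walks_gt0 _ Ebb').
have SW : q ^ t * S <= q.-1 ^ t * W.
  rewrite !big_distrr /=; apply: leq_sum => c _.
  by apply: leq_trans (block_walks_decay _ _); rewrite leq_mul2l Lang_block_walks orbT.
rewrite prednK // in Kt.
have : 0 < q ^ t by rewrite expn_gt0 q_gt0.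
move: Kt SW W_gt0; set x := q ^ t; set y := q.-1 ^ t; nia.
Qed.
End Walks.

(** * Markov approximations of a memoryless map *)

Definition pseudo_orbit (X : Type) (R : X -> X -> Prop) (psi : X -> X)
  (y : nat -> X) := forall i, R (psi (y i)) (y i.+1).

Definition traced (X : Type) (R : X -> X -> Prop) (psi : X -> X)
  (y : nat -> X) (n : nat) := exists x, forall i, i <= n -> R (iter i psi x) (y i).

(** The same relation measures the jumps and the tracing error. For the kernel of a map to a finite
    set, every finite path of the transition graph is then the itinerary of a point: the fibres form
    a Markov partition. *)
Definition markov (X : Type) (R : X -> X -> Prop) (psi : X -> X) :=
  forall y, pseudo_orbit R psi y -> forall n, traced R psi y n.

Definition agree (X A : Type) (P : X -> A) (tau : X -> X) (k : nat) (x y : X) :=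
  forall j, j < k -> P (iter j tau x) = P (iter j tau y).

Definition block (X : Type) (A : finType) (P : X -> A) (tau : X -> X) (k : nat) (x : X) :=
  [ffun j : 'I_k => P (iter j tau x)].

Lemma blockP (X : Type) (A : finType) (P : X -> A) (tau : X -> X) (k : nat) (x y : X) :
  block P tau k x = block P tau k y <-> agree P tau k x y.
Proof.
split=> [xy j jk|xy]; last by apply/ffunP => j; rewrite !ffunE xy.
by have /ffunP/(_ (Ordinal jk)) := xy; rewrite !ffunE.
Qed.

Definition agree_forward (X A : Type) (P : X -> A) (tau : X -> X) (x y : X) :=
  forall j, P (iter j tau x) = P (iter j tau y).

(** The symbolic form of the weakly p-L condition; for the pair of inverses it is that of the weakly
    q-R condition. *)
Definition anticipates (X A : Type) (P : X -> A) (tau psi : X -> X) (M : nat) :=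
  forall x y, agree P tau M.+1 x y -> P (psi x) = P (psi y).

(** In the coordinates [P] this is the finite type condition: a past and a future overlapping in [s]
    letters can be joined. *)
Definition glues (X A : Type) (P : X -> A) (tau tau' : X -> X) (s : nat) :=
  forall x y, agree P tau s x y ->
  exists2 w, agree_forward P tau w y & agree_forward P tau' w x.

Section Core.
Local Open Scope nat_scope.
Variables (X : Type) (A : finType) (tau tau' psi psi' : X -> X) (P : X -> A).
Hypotheses (tauK : cancel tau tau') (tauVK : cancel tau' tau).
Hypothesis psiVK : cancel psi' psi.
Hypothesis tau_psi : forall x, tau (psi x) = psi (tau x).
Variables (M s : nat).
Hypothesis P_anticipates : anticipates P tau psi M.
Hypothesis P_glues : glues P tau tau' s.

Definition cell (c a : nat) (x : X) := P (iter c tau (iter a psi x)).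

Definition window (k N : nat) (x y : X) :=
  forall c a, c < k -> a <= N -> cell c a x = cell c a y.

Lemma window_sym k N x y : window k N x y -> window k N y x.
Proof. by move=> xy c a ck aN; rewrite xy. Qed.

Lemma window_trans k N y x z :
  window k N x y -> window k N y z -> window k N x z.
Proof. by move=> xy yz c a ck aN; rewrite xy // yz. Qed.

Lemma window_sub k N k' N' x y :
  k' <= k -> N' <= N -> window k N x y -> window k' N' x y.
Proof.
by move=> kk NN xy c a ck aN; apply: xy; [exact: leq_trans kk|exact: leq_trans NN].
Qed.

Lemma iter_cancel (f f' : X -> X) n : cancel f f' -> cancel (iter n f) (iter n f').
Proof. by move=> fK; elim: n => [|n IH] x //; rewrite iterSr [iter _.+1 f x]iterS fK. Qed.

Lemma iter_tau_psi c a x : iter c tau (iter a psi x) = iter a psi (iter c tau x).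
Proof.
elim: a => [|a IH] //=; rewrite -IH.
by elim: c {IH} => [|c IH] //=; rewrite IH tau_psi.
Qed.

Lemma cell_psi c a b x : cell c a (iter b psi x) = cell c (a + b) x.
Proof. by rewrite /cell iterD. Qed.

Lemma cell_tau c a d x : cell c a (iter d tau x) = cell (c + d) a x.
Proof. by rewrite /cell -iter_tau_psi iterD. Qed.

Lemma window_psi k N a x y :
  window k (N + a) x y -> window k N (iter a psi x) (iter a psi y).
Proof. by move=> xy c b ck bN; rewrite !cell_psi xy // leq_add2r. Qed.

Lemma window_tau k N m x y :
  window (k + m) N x y -> window k N (iter m tau x) (iter m tau y).
Proof. by move=> xy c b ck bN; rewrite !cell_tau xy // ltn_add2r. Qed.

Lemma anticipates_cell c a x y :
  (forall j, j <= M -> cell (c + j) a x = cell (c + j) a y) ->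
  cell c a.+1 x = cell c a.+1 y.
Proof.
have psiE u : iter c tau (iter a.+1 psi u) = psi (iter c tau (iter a psi u)).
  by rewrite !iter_tau_psi.
move=> xy; rewrite /cell !psiE; apply: P_anticipates => j; rewrite ltnS => jM.
by have := xy j jM; rewrite addnC /cell !iterD.
Qed.

(** Each row is determined by the row below it, at the cost of [M] columns on the right. *)
Lemma agree_window K N x y :
  agree P tau (K + M * N) x y -> window K N x y.
Proof.
move=> xy c a cK aN; have : c + M * a < K + M * N.
  by rewrite -addSn leq_add // leq_mul2l aN orbT.
elim: a c {cK aN} => [|a IH] c cK; first by apply: xy; rewrite muln0 addn0 in cK.
by apply: anticipates_cell => j jM; apply: IH; nia.
Qed.

Lemma agree_forward_window k N x y : agree_forward P tau x y -> window k N x y.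
Proof. by move=> xy; apply: agree_window => j _; exact: xy. Qed.

Lemma agree_forward_psi x y :
  agree_forward P tau x y -> agree_forward P tau (psi x) (psi y).
Proof.
move=> xy j.
have /(_ j 1 (ltnSn j) (leqnn 1)) := @agree_forward_window j.+1 1 x y xy.
by [].
Qed.

(* The past of [x] is glued to the future of [y], and the columns on the left of
   the seam are then forced by anticipation. *)
Lemma window_lift k m N x y : s <= k -> M <= k ->
  window k N (iter m tau x) y ->
  exists2 z, window (k + m) N x z & agree_forward P tau (iter m tau z) y.
Proof.
move=> sk Mk xy; have [|w wy wx] := P_glues (x := iter m tau x) (y := y).
  by move=> j js; apply: (xy j 0) => //; exact: leq_trans sk.
exists (iter m tau' w); last by rewrite (iter_cancel _ tauVK).
have zy c a : cell (c + m) a (iter m tau' w) = cell c a y.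
  rewrite -cell_tau (iter_cancel _ tauVK).
  exact: (agree_forward_window (k := c.+1) (N := a) wy).
move=> c a ckm aN; elim: a c ckm aN => [|a IH] c ckm aN; have [cm|mc] := ltnP c m.
- rewrite /cell /=; have := wx (m - c).
  rewrite -[in iter m tau x](subnKC (ltnW cm)) addnC iterD (iter_cancel _ tauK) => <-.
  by rewrite -[in iter m tau' w](subnKC (ltnW cm)) iterD (iter_cancel _ tauVK).
- by rewrite -(subnK mc) zy -cell_tau; apply: xy; rewrite // ltn_subLR // addnC.
- apply: anticipates_cell => j jM; apply: IH (ltnW aN).
  by rewrite addnC -addnS leq_add // (leq_trans jM).
- by rewrite -(subnK mc) zy -cell_tau; apply: xy; rewrite // ltn_subLR // addnC.
Qed.

Notation pseudo k N := (pseudo_orbit (window k N) psi).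

Lemma orbit_pseudo k N x : pseudo k N (fun i => iter i psi x).
Proof. by []. Qed.

Lemma pseudo_sub k N k' N' y :
  k' <= k -> N' <= N -> pseudo k N y -> pseudo k' N' y.
Proof. by move=> kk NN py i; exact: window_sub (py i). Qed.

(** If [z i] has the columns of [y i] from the seam on, then by memorylessness so do their images.
    The image of [y i] agrees with [y i.+1] on a window, so [window_lift] supplies [z i.+1]. *)
Lemma pseudo_lift k m N x y : s <= k -> M <= k -> pseudo k N y ->
  window k N (iter m tau x) (y 0) ->
  exists z, [/\ pseudo (k + m) N z, window (k + m) N x (z 0) &
    forall i, agree_forward P tau (iter m tau (z i)) (y i)].
Proof.
move=> sk Mk py xy0.
have [z0 xz0 z0y] := window_lift sk Mk xy0.
have step (p : nat * X) : exists z', agree_forward P tau (iter m tau p.2) (y p.1) ->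
    window (k + m) N (psi p.2) z' /\ agree_forward P tau (iter m tau z') (y p.1.+1).
  (* The default [p.2] only makes the choice function total; along [z] the premise always holds. *)
  have [zy|] := pselect (agree_forward P tau (iter m tau p.2) (y p.1)); last by exists p.2.
  have zy' : window k N (iter m tau (psi p.2)) (psi (y p.1)).
    rewrite -[psi p.2]/(iter 1 psi p.2) iter_tau_psi.
    by apply: agree_forward_window; exact: agree_forward_psi.
  by have [z' ? ?] := window_lift sk Mk (window_trans zy' (py p.1)); exists z'.
have [f fP] := choice step.
pose z := fix z i := if i is i'.+1 then f (i', z i') else z0.
have zy i : agree_forward P tau (iter m tau (z i)) (y i).
  by elim: i => [|i IH] //=; have [] := fP (i, z i) IH.
by exists z; split=> // i; have [] := fP (i, z i) (zy i).
Qed.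

(** A wide pseudo-orbit is a true orbit on its left: the bottom row of [z 0] forces a triangle of
    cells of slope [M], which still covers the [k] leftmost columns after [n] steps. *)
Lemma pseudo_orbit_start k m N n z : pseudo (k + m) N z -> M * (n + N) <= m ->
  forall i, i <= n -> window k N (iter i psi (z 0)) (z i).
Proof.
move=> pz Mm i i_le_n.
have row j c : c + M * j < k + m -> cell c j (z 0) = cell c 0 (z j).
  elim: j c => [|j IH] c cj //.
  have <- : cell c 1 (z j) = cell c 0 (z j.+1).
    by have /= <- := pz j c 0 _ isT => //; lia.
  have := @anticipates_cell c 0 (iter j psi (z 0)) (z j).
  rewrite cell_psi add1n; apply => e eM.
  by rewrite cell_psi add0n; apply: IH; nia.
apply: agree_window => j jk.
have := row i j; rewrite /cell /=; apply; nia.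
Qed.

Lemma pseudo_cell K N z e a i c : pseudo K N z -> c < K -> a + e <= N ->
  cell c (a + e) (z i) = cell c a (z (i + e)).
Proof.
move=> pz cK; elim: e a i => [|e IH] a i aeN; first by rewrite !addn0.
rewrite [in RHS]addnS -(pz (i + e) c a cK); last by lia.
rewrite -[psi _]/(iter 1 psi _) cell_psi -IH; last by lia.
by congr cell; lia.
Qed.

Variables (k0 r : nat).
(** Left expansiveness made finite by compactness: [k0] columns determine the next column on the
    right in their middle row. *)
Hypothesis P_expands : forall x y,
  window k0 r.*2 x y -> cell k0 r x = cell k0 r y.

(** Columns are recovered one at a time from left to right, each at the cost of [r] time steps at
    both ends. *)
Lemma window_expands k m N n z z' : k0 <= k -> r.*2 <= N ->
  pseudo (k + m) N z -> pseudo (k + m) N z' ->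
  (forall i, i <= n -> window k N (z i) (z' i)) ->
  forall i, m * r <= i -> i + m * r <= n -> window (k + m) N (z i) (z' i).
Proof.
move=> k0k rN pz pz' zz.
elim: m pz pz' => [|m IH] pz pz' i mri imn; first by rewrite addn0; apply: zz; lia.
rewrite addnS in pz pz' *.
have {}IH := IH (pseudo_sub (leqnSn _) (leqnn N) pz)
  (pseudo_sub (leqnSn _) (leqnn N) pz').
move=> c a; rewrite ltnS leq_eqVlt => /orP[/eqP-> aN|cm aN]; last first.
  by apply: IH => //; nia.
have centre j : m * r <= j -> j + m * r <= n -> forall b, r <= b -> b + r <= N ->
    cell (k + m) b (z j) = cell (k + m) b (z' j).
  move=> mj jn b rb bN.
  have shift u : cell (k + m) b u =
      cell k0 r (iter (k + m - k0) tau (iter (b - r) psi u)).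
    rewrite cell_tau cell_psi; congr cell; lia.
  rewrite !shift; apply: P_expands => c' a' c'k a'r.
  rewrite !cell_tau !cell_psi; apply: IH => //; lia.
(* A row near the bottom or the top of a window is an inner row of an earlier or a later window of
   the same pseudo-orbit. *)
have [ar|ra] := ltnP a r.
  have -> : i = i - (r - a) + (r - a) by nia.
  rewrite -!(pseudo_cell _ (K := (k + m).+1) (N := N)) //; try lia.
  by apply: centre; nia.
have [aNr|Nra] := leqP (a + r) N; first by apply: centre; nia.
have -> : a = N - r + (a - (N - r)) by lia.
rewrite !(pseudo_cell _ _ (K := (k + m).+1) (N := N)) //; try lia.
by apply: centre; nia.
Qed.

Lemma pseudo_cat k N n y u : pseudo k N y -> pseudo k N u ->
  window k N (y n) (u 0) -> pseudo k N (fun i => if i < n then y i else u (i - n)).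
Proof.
move=> py pu yu i /=; case: (ltnP i n) => [i_lt|n_le_i]; last first.
  by rewrite ltnNge leqW // subSn //; exact: pu.
case: (ltnP i.+1 n) => [_|n_le]; first exact: py.
have ni : n = i.+1 by lia.
by rewrite ni subnn in yu *; exact: window_trans (py i) yu.
Qed.

Definition win k N (x : X) : {ffun 'I_k * 'I_N.+1 -> A} :=
  [ffun c : 'I_k * 'I_N.+1 => cell c.1 c.2 x].

Lemma winP k N x y : win k N x = win k N y <-> window k N x y.
Proof.
split=> [xy c a ck aN|xy]; last by apply/ffunP => c; rewrite !ffunE xy // -ltnS.
have aN' : a < N.+1 by [].
by move/ffunP: xy => /(_ (Ordinal ck, Ordinal aN')); rewrite !ffunE.
Qed.

(** Supplied below by the density of periodic points; it makes every edge of the graph of windows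
    lie on a cycle. *)
Hypothesis psi_recurrent : forall k N x,
  exists y n, window k N y x /\ window k N (iter n.+1 psi y) x.

Definition good k N x :=
  forall y, pseudo k N y -> window k N x (y 0) -> forall n, traced (window k N) psi y n.

Lemma good_window k N x x' : window k N x x' -> good k N x -> good k N x'.
Proof. by move=> xx' gx y py x'y; apply: gx => //; exact: window_trans x'y. Qed.

Lemma good_pseudo k N x y i :
  pseudo k N y -> window k N x (y 0) -> good k N x -> good k N (y i).
Proof.
move=> py xy gx u pu yu n.
case: i py yu => [|i] py yu; first exact: (gx _ pu (window_trans xy yu) n).
have [w wP] := gx _ (pseudo_cat py pu yu) xy (n + i.+1).
exists (iter i.+1 psi w) => j jn.
have := wP (j + i.+1); rewrite leq_add2r => /(_ jn).
by rewrite ltnNge leq_addl /= addnK iterD.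
Qed.

(** Being good passes forwards along pseudo-orbits, and by recurrence an orbit leads from the window
    of [psi x] back to that of [x]. The extra row in [N.+1] makes the recurrent point agree with [x]
    also after one step. *)
Lemma good_psi_back k N x : good k N (psi x) -> good k N x.
Proof.
move=> gx; have [y [n [yx ynx]]] := psi_recurrent k N.+1 x.
apply: good_window (window_sub (leqnn k) (leqnSn N) ynx) _.
rewrite iterSr; apply: (@good_pseudo _ _ (psi x) (fun i => iter i psi (psi y))) gx => //.
by apply: window_sym; apply: (@window_psi k N 1); rewrite addn1.
Qed.

(** Start [r] steps earlier, at [x0], and lift the pseudo-orbit by one column to the left, so that
    it starts in the good window of [x0] and is traced there. By [window_expands] the traced orbit
    is also right in the last column, except for [r] steps at each end. *)
Lemma good_tau k N x : k0 <= k -> r.*2 <= N -> s <= k -> M <= k ->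
  good k N x -> good k N (tau x).
Proof.
move=> k0k rN sk Mk gx y py xy n.
pose x0 := iter r psi' x.
have x0E i : iter i psi (iter i psi' x) = x by exact: iter_cancel.
have gx0 : good k N x0.
  rewrite /x0; have := gx; rewrite -{1}(x0E r).
  by elim: (r) (iter r psi' x) => [|i IH] v //= /good_psi_back; exact: IH.
pose y' i := if i < r then iter i psi (tau x0) else y (i - r).
have py' : pseudo k N y'.
  apply: pseudo_cat => //=.
  by rewrite -[tau x0]/(iter 1 tau x0) -iter_tau_psi x0E.
have y'0 : window k N (iter 1 tau x0) (y' 0).
  by rewrite /y' /= /x0; case: (r) => [|i].
have [z [pz xz zy]] := pseudo_lift sk Mk py' y'0.
have [w wP] := gx0 z (pseudo_sub (leq_addr 1 k) (leqnn N) pz)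
  (window_sub (leq_addr 1 k) (leqnn N) xz) (n + r + r).
have pw : pseudo (k + 1) N (fun i => iter i psi w) by [].
have {}wP := window_expands k0k rN pw pz wP.
exists (iter r psi (tau w)) => i i_le_n.
rewrite -iterD -[tau w]/(iter 1 tau w) -iter_tau_psi.
have := wP (i + r); rewrite mul1n leq_addl !leq_add2r => /(_ isT i_le_n).
move/window_tau/window_trans; apply.
have := agree_forward_window (k := k) (N := N) (zy (i + r)).
by rewrite /y' ltnNge leq_addl /= addnK.
Qed.

(** * The graph of windows and the count of its paths *)

Definition edge k N : rel {ffun 'I_k * 'I_N.+1 -> A} :=
  fun b b' => `[< exists x, win k N x = b /\ win k N (psi x) = b' >].

Arguments edge k N : clear implicits.

Lemma edge_back k N b b' : edge k N b b' -> connect (edge k N) b' b.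
Proof.
case/asboolP => x [<- <-]; have [y [n [yx ynx]]] := psi_recurrent k N.+1 x.
have -> : win k N (psi x) = win k N (iter 1 psi y).
  by apply/winP/window_sym; apply: (@window_psi k N 1); rewrite addn1.
have -> : win k N x = win k N (iter n psi (iter 1 psi y)).
  apply/winP; rewrite -iterD addn1; apply: window_sym.
  exact: window_sub (leqnn k) (leqnSn N) ynx.
elim: n {ynx} => [|n IH]; first exact: connect0.
by apply: connect_trans IH (connect1 _); apply/asboolP; exists (iter n psi (iter 1 psi y)).
Qed.

Definition trajectory k N (z : nat -> X) n := mkseq (fun i => win k N (z i)) n.

Lemma trajectoryS k N z n :
  trajectory k N z n.+1 = win k N (z 0) :: trajectory k N (fun i => z i.+1) n.
Proof. by rewrite /trajectory /mkseq /= -[1]addn0 iotaDl -map_comp. Qed.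

Lemma path_trajectory k N z n : pseudo k N z ->
  path (edge k N) (win k N (z 0)) [seq win k N (z i) | i <- iota 1 n].
Proof.
move=> pz; elim: n 0 => [|n IH] i //=; rewrite IH andbT.
by apply/asboolP; exists (z i); split=> //; apply/winP; exact: pz.
Qed.

Lemma path_pseudo k N x u : path (edge k N) (win k N x) u ->
  exists2 y, pseudo k N y & win k N x :: u = trajectory k N y (size u).+1.
Proof.
elim: u x => [|c u IH] x /=; first by exists (fun i => iter i psi x).
case/andP => /asboolP[x1 [x1x <-]] /IH[y py yu].
exists (fun i => if i is i'.+1 then y i' else x1).
  move=> [|i]; last exact: py.
  by apply/winP; move: yu; rewrite /trajectory /mkseq /= => -[].
by rewrite yu [RHS]trajectoryS /= x1x.
Qed.

(** A trajectory shows the [k] leftmost of the [k + m] columns, so these are the words that extend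
    to the right by [m] columns. *)
Definition lifted k m N (u : seq {ffun 'I_k * 'I_N.+1 -> A}) : bool :=
  `[< exists2 z, pseudo (k + m) N z & u = trajectory k N z (size u) >].

Lemma lifted_infix k m N u1 u2 u3 :
  lifted m (u1 ++ u2 ++ u3) -> @lifted k m N u2.
Proof.
case/asboolP => z pz uz; apply/asboolP; exists (fun i => z (i + size u1)).
  by move=> i; exact: pz.
have nthu i : i < size u1 + (size u2 + size u3) ->
    nth (win k N (z 0)) (u1 ++ u2 ++ u3) i = win k N (z i).
  by move=> i_lt; rewrite uz nth_mkseq // !size_cat.
apply: (@eq_from_nth _ (win k N (z 0))) => [|i i_lt]; first by rewrite size_mkseq.
rewrite nth_mkseq // -(nthu (i + size u1)); last by lia.
by rewrite nth_cat ltnNge leq_addl /= addnK nth_cat i_lt.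
Qed.

Section Pairs.
Variables (T : finType) (n : nat) (Q : T -> n.-tuple T -> bool).

Lemma card_pairs : \sum_c #|[set u : n.-tuple T | Q c u]| =
  #|[set p : T * n.-tuple T | Q p.1 p.2]|.
Proof.
rewrite -[RHS]sum1dep_card -(pair_big_dep xpredT Q (fun _ _ => 1)) /=.
by apply: eq_bigr => c _; rewrite sum1dep_card.
Qed.
End Pairs.

(** Lift every path by [m] columns to the left. The [k] leftmost columns of the lift form a lifted
    word, and together with the windows at both ends they determine the lift, hence the path. *)
Lemma lifted_dense k m N (x0 : X) : k0 <= k -> r.*2 <= N -> s <= k -> M <= k ->
  exists K, forall n, 0 < n ->
    \sum_b walks (edge k N) n b <=
    K * \sum_b #|[set u : n.-tuple _ | path (edge k N) b u && lifted m (b :: u)]|.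
Proof.
move=> k0k rN sk Mk.
pose W := {ffun 'I_k * 'I_N.+1 -> A}; pose L := {ffun 'I_(k + m) * 'I_N.+1 -> A}.
(* [F] records the [m * r] windows at one end, where [window_expands] gives nothing. *)
pose F := {ffun 'I_(m * r) -> L}.
exists (#|F| * #|F|) => n n_gt0; rewrite /walks !card_pairs mulnC.
have lift (p : W * n.-tuple W) : exists z, path (edge k N) p.1 p.2 ->
    pseudo (k + m) N z /\
    p.1 :: p.2 = trajectory k N (fun i => iter m tau (z i)) n.+1.
  case: p => b u /=; have [pu|] := boolP (path (edge k N) b u); last by exists (fun=> x0).
  have [x xb] : exists x, win k N x = b.
    case: u pu n_gt0 => -[|c u] su /=; first by rewrite -(eqP su).
    by case/andP => /asboolP[x [<- _]] _ _; exists x.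
  move: pu; rewrite -xb => /path_pseudo[y py uy].
  have xy : window k N x (y 0) by apply/winP; case: uy.
  have [x1 yx] : exists x1, iter m tau x1 = x.
    by exists (iter m tau' x); exact: iter_cancel.
  rewrite -{}yx in xy.
  have [z [pz _ zy]] := pseudo_lift sk Mk py xy.
  exists z => _; split=> //; rewrite xb in uy *; rewrite uy size_tuple.
  apply: eq_map => i; apply/esym/winP; exact: agree_forward_window (zy i).
have [zf zfP] := choice lift.
pose f p : (W * n.-tuple W) * (F * F) :=
  ((win k N (zf p 0), [tuple win k N (zf p i.+1) | i < n]),
   ([ffun i : 'I_(m * r) => win (k + m) N (zf p i)],
    [ffun i : 'I_(m * r) => win (k + m) N (zf p (n - i))])).
rewrite -[#|F| * #|F|]card_prod -[#|{: F * F}|]cardsT -cardsX.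
have f_inj : {in [set p : W * n.-tuple W | path (edge k N) p.1 p.2] &, injective f}.
  move=> [b u] [b' u']; rewrite !inE => /(zfP (_, _))[pz uz] /(zfP (_, _))[pz' uz'].
  rewrite /f; set z := zf (b, u) in pz uz *; set z' := zf (b', u') in pz' uz' *.
  move=> fE; have /= zz0 := congr1 (fun q => q.1.1) fE.
  have /= zzS := congr1 (fun q => q.1.2) fE.
  have /= /ffunP zzl := congr1 (fun q => q.2.1) fE.
  have /= /ffunP zzr := congr1 (fun q => q.2.2) fE.
  have zz i : i <= n -> window k N (z i) (z' i).
    case: i => [_|i i_lt]; first exact/winP.
    have /(congr1 (fun t => tnth t (Ordinal i_lt))) := zzS.
    by rewrite !tnth_mktuple => /winP.
  have zzm i : i <= n -> win (k + m) N (z i) = win (k + m) N (z' i).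
    move=> i_le; have [i_lt|i_ge] := ltnP i (m * r).
      by have := zzl (Ordinal i_lt); rewrite !ffunE.
    have [i_lt|{}i_lt] := ltnP (n - i) (m * r).
      by have := zzr (Ordinal i_lt); rewrite !ffunE /= subKn.
    by apply/winP; apply: (window_expands k0k rN pz pz' zz) => //; lia.
  have : b :: u = b' :: u'.
    rewrite /= in uz uz' *; rewrite uz uz'; apply/eq_in_map => i.
    rewrite mem_iota add0n ltnS => /andP[_ /zzm/winP]; rewrite addnC => zzi.
    by apply/winP/window_tau; rewrite addnC.
  by case=> -> uu; congr pair; exact: val_inj.
rewrite -(card_in_imset f_inj). apply: subset_leq_card.
apply/fintype.subsetP => q0 /imsetP[[b u]]; rewrite finset.inE /= => bu ->.
have [pz _] := zfP (b, u) bu.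
rewrite finset.in_setX !finset.inE andbT /=.
set z := zf (b, u) in pz *.
have -> : [seq win k N (z (val i).+1) | i <- enum 'I_n] =
  [seq win k N (z i) | i <- iota 1 n].
  by rewrite -[iota 1 n]/(iota (1 + 0) n) iotaDl -val_enum_ord -!map_comp.
rewrite path_trajectory; last exact: pseudo_sub (leq_addr _ _) (leqnn _) pz.
by apply/asboolP; exists z => //=; rewrite size_map size_iota.
Qed.

(* Otherwise every vertex starts an untraced path of a common length [l]. Such a path
   does not extend to the right by [m = M * (l + N)] columns, so [Lang_sparse]
   contradicts [lifted_dense]. *)
Lemma exists_good k N (x0 : X) : k0 <= k -> r.*2 <= N -> s <= k -> M <= k ->
  exists x, good k N x.
Proof.
move=> k0k rN sk Mk; apply: contrapT => /forallNP no_good.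
have bad (b : {ffun 'I_k * 'I_N.+1 -> A}) : exists n, forall x, win k N x = b ->
    exists y, [/\ pseudo k N y, window k N x (y 0) & ~ traced (window k N) psi y n].
  have [[x xb]|nox] := pselect (exists x, win k N x = b); last first.
    by exists 0 => x xb; case: nox; exists x.
  have /existsNP[y /not_implyP[py /not_implyP[xy /existsNP[n ny]]]] := no_good x.
  exists n => x' x'b; exists y; split=> //; apply: window_trans xy.
  by apply/winP; rewrite xb.
have [nb nbP] := choice bad.
pose l := (\sum_b nb b).+1; pose m := M * (l + N).
have miss b b' : edge k N b b' -> exists u : l.-tuple _,
    path (edge k N) b u /\ ~~ lifted m (b :: u).
  case/asboolP => x [xb _]; have [y [py xy yN]] := nbP b x xb.
  have yb : win k N (y 0) = b by rewrite -xb; apply/winP; exact: window_sym.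
  have su : size [seq win k N (y i) | i <- iota 1 l] == l by rewrite size_map size_iota.
  exists (Tuple su); rewrite -yb path_trajectory //; split=> //.
  apply/asboolPn => -[z pz] /=; rewrite size_map size_iota => zy.
  apply: yN; exists (z 0) => i i_nb.
  have il : i <= l by rewrite (leq_trans i_nb) // /l (bigD1 b) //= leqW // leq_addr.
  apply: window_trans (pseudo_orbit_start pz (leqnn _) il) _; apply/winP.
  have /(congr1 (fun t => nth b t i)) := zy.
  have -> : win k N (y 0) :: [seq win k N (y i) | i <- iota 1 l] = trajectory k N y l.+1.
    by rewrite trajectoryS /trajectory /mkseq -[iota 1 l]/(iota (1 + 0) l) iotaDl -map_comp.
  by rewrite !nth_mkseq // ltnS.
have [K denseK] := lifted_dense m x0 k0k rN sk Mk.
have x0_edge : edge k N (win k N x0) (win k N (psi x0)) by apply/asboolP; exists x0.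
have [n n_gt0] := Lang_sparse (@edge_back k N) (@lifted_infix k m N) (ltn0Sn _) miss K x0_edge.
by rewrite ltnNge denseK.
Qed.

(** Mixing of [tau], in the form that a nonempty union of windows mapped into itself by a positive
    power of [tau] is everything. *)
Hypothesis tau_indecomposable : forall (k N q : nat) (U : X -> Prop),
  (forall x y, window k N x y -> U x -> U y) ->
  (exists x, U x) -> (forall x, U x -> U (iter q.+1 tau x)) -> forall x, U x.

Lemma window_markov k N : k0 <= k -> r.*2 <= N -> s <= k -> M <= k ->
  markov (window k N) psi.
Proof.
move=> k0k rN sk Mk y py n.
suff gx x : good k N x by exact: (gx (y 0) y py).
apply: (@tau_indecomposable k N 0 (good k N)) => [||z]; last exact: good_tau.
- by move=> ? ?; exact: good_window.
- exact: exists_good (y 0) _ _ _ _.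
Qed.

(** * Mixing of [psi] on windows *)

Section Mixing.
Variables (k N : nat).
Hypotheses (k0k : k0 <= k) (rN : r.*2 <= N) (sk : s <= k) (Mk : M <= k).

Definition leads n x y := exists2 w, window k N w x & window k N (iter n psi w) y.

Lemma leads_orbit n x : leads n x (iter n psi x). Proof. by exists x. Qed.

Lemma leads_window n x x' y y' :
  window k N x x' -> window k N y y' -> leads n x y -> leads n x' y'.
Proof.
by move=> xx' yy' [w wx wy]; exists w; [exact: window_trans xx'|exact: window_trans yy'].
Qed.

Lemma leads_trans n n' x y z : leads n x y -> leads n' y z -> leads (n' + n) x z.
Proof.
move=> [w wx wy] [v vy vz].
have py := pseudo_cat (@orbit_pseudo k N w) (@orbit_pseudo k N v)
  (window_trans wy (window_sym vy)).
have [u uP] := window_markov k0k rN sk Mk py (n' + n).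
exists u; last first.
  apply: window_trans (uP _ (leqnn _)) _.
  by rewrite ltnNge leq_addl /= addnK.
have [n0|n_gt0] := posnP n; last first.
  by apply: window_trans (uP 0 (leq0n _)) _; rewrite n_gt0.
apply: window_trans (uP 0 (leq0n _)) _; rewrite n0 /=.
rewrite n0 in wy; exact: window_trans vy (window_trans (window_sym wy) wx).
Qed.

(** Each step from [w] to [psi w] lies on a cycle of some length [c.+1]. Finishing that cycle and
    running through it [p.-1] more times returns to [w] after a total of [p * c.+1] steps. *)
Lemma leads_back p n x y : 0 < p -> leads n x y ->
  exists2 n', leads n' y x & p %| n + n'.
Proof.
move=> p_gt0 [w wx wy].
suff [n' n'w pn'] : exists2 n', leads n' (iter n psi w) w & p %| n + n'.
  by exists n' => //; exact: leads_window n'w.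
elim: n {wy} => [|n [n' n'w pn']]; first by exists 0; [exact: (leads_orbit 0)|].
have [v [c [vw cw]]] := psi_recurrent k N.+1 (iter n psi w).
have cycle : leads c.+1 (iter n psi w) (iter n psi w).
  by exists v; apply: window_sub (leqnn k) (leqnSn N) _.
have back : leads c (iter n.+1 psi w) (iter n psi w).
  exists (psi v); first by apply: (@window_psi k N 1); rewrite addn1.
  by rewrite -iterSr; apply: window_sub (leqnn k) (leqnSn N) _.
have cycles i : leads (i * c.+1) (iter n psi w) (iter n psi w).
  by elim: i => [|i IH]; [exact: leads_orbit|rewrite mulSn; exact: leads_trans IH cycle].
exists (n' + (p.-1 * c.+1 + c)); first exact: leads_trans (leads_trans back (cycles p.-1)) n'w.
have -> : n.+1 + (n' + (p.-1 * c.+1 + c)) = n + n' + (p.-1.+1 * c.+1) by rewrite mulSn; lia.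
by rewrite prednK // (dvdn_add pn' (dvdn_mulr _ (dvdnn p))).
Qed.

Definition conn p x y := exists2 n, p %| n & leads n x y.

Lemma conn_sym p x y : 0 < p -> conn p x y -> conn p y x.
Proof.
move=> p_gt0 [n pn /(leads_back p_gt0)[n' n'yx]].
by rewrite dvdn_addr // => pn'; exists n'.
Qed.

Lemma conn_trans p y x z : conn p x y -> conn p y z -> conn p x z.
Proof.
move=> [n pn nxy] [n' pn' n'yz]; exists (n' + n); first exact: dvdn_add.
exact: leads_trans nxy n'yz.
Qed.

(* A path from [x] to [x'] is extended by true orbits at both ends, so that the traced
   orbit has the same column on the right there. *)
Lemma conn_tau p x x' : 0 < p -> conn p x x' -> conn p (tau x) (tau x').
Proof.
move=> p_gt0 [n pn [w wx wx']].
(* The times [0, ..., r.*2] before [b] suffice to recover one more column at time [r]. *)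
pose b := r.*2.+1; pose xb := iter b psi' x.
have xbE : iter b psi xb = x by exact: iter_cancel.
pose v i := if i < n then iter i psi w else iter (i - n) psi x'.
pose u i := if i < b then iter i psi xb else v (i - b).
have pv : pseudo k N v by apply: pseudo_cat.
have pu : pseudo k N u.
  apply: pseudo_cat => //; rewrite xbE /v.
  case: posnP => [n0|_]; last exact: window_sym.
  by rewrite n0 in wx'; exact: window_trans (window_sym wx) wx'.
have [y yP] := window_markov k0k rN sk Mk pu (b + n + r.*2).
have early : window k N (iter r psi (tau y)) (iter r psi (tau xb)).
  rewrite -[tau y]/(iter 1 tau y) -[tau xb]/(iter 1 tau xb) -!iter_tau_psi.
  apply: window_tau.
  apply: (@window_expands k 1 N r.*2 (fun i => iter i psi y) (fun i => iter i psi xb)) => //;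
    rewrite ?mul1n -?addnn // => i i_le.
  have := yP i; rewrite /u ltnS -addnn i_le; apply; lia.
have late : window k N (iter (b + n + r) psi (tau y)) (iter r psi (tau x')).
  rewrite -[tau y]/(iter 1 tau y) -[tau x']/(iter 1 tau x') -!iter_tau_psi.
  rewrite addnC iterD; apply: window_tau.
  apply: (@window_expands k 1 N r.*2 (fun i => iter i psi (iter (b + n) psi y))
    (fun i => iter i psi x')) => //; rewrite ?mul1n -?addnn // => i i_le.
  have := yP (b + n + i); rewrite /u /v -iterD [i + _]addnC.
  have -> : b + n + i < b = false by lia.
  have -> : b + n + i - b < n = false by lia.
  have -> : b + n + i - b - n = i by lia.
  by apply; lia.
(* The detours to the early and from the late point are undone modulo [p] by [leads_back]. *)
have [n1 n1P pn1] : exists2 n1, leads n1 (tau x) (iter r psi (tau xb)) & p %| (b - r) + n1.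
  apply: leads_back => //.
  have -> : tau x = iter (b - r) psi (iter r psi (tau xb)).
    rewrite -iterD subnK; last by rewrite /b; lia.
    by rewrite -[tau xb]/(iter 1 tau xb) -iter_tau_psi xbE.
  exact: leads_orbit.
have [n2 n2P pn2] := leads_back p_gt0 (leads_orbit r (tau x')).
have mid : leads (b + n) (iter r psi (tau xb)) (iter r psi (tau x')).
  by exists (iter r psi (tau y)); rewrite -?iterD.
exists (n2 + (b + n + n1)); last exact: leads_trans (leads_trans n1P mid) n2P.
have -> : n2 + (b + n + n1) = n + ((b - r + n1) + (r + n2)) by rewrite /b; lia.
exact: dvdn_add pn (dvdn_add pn1 pn2).
Qed.

(** By pigeonhole some [y0] shares its window with [iter q tau y0], so its class modulo [p] is
    preserved by [iter q tau] and is everything. Applied with [p] the length of a cycle at [x], this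
    gives paths of every residue, which the cycle prolongs. *)
Lemma window_leads x x' : exists n0, forall n, n0 <= n -> leads n x x'.
Proof.
have conn_all p : 0 < p -> forall y y', conn p y y'.
  move=> p_gt0; have [i [i' [ii' wii']]] : exists i i', i < i' /\
      window k N (iter i tau x) (iter i' tau x).
    pose f (i : 'I_#|{ffun 'I_k * 'I_N.+1 -> A}|.+1) := win k N (iter i tau x).
    have /injectivePn[i [i' ii' /winP fi]] : ~~ injectiveb f.
      by apply/injectiveP => /leq_card; rewrite card_ord ltnn.
    have [i_lt|i_gt|/val_inj i_eq] := ltngtP i i'; [by exists i, i'| |by rewrite i_eq eqxx in ii'].
    by exists i', i; split=> //; exact: window_sym.
  pose y0 := iter i tau x; pose q := i' - i.
  have y0q : conn p y0 (iter q tau y0).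
    by exists 0 => //; exists y0; rewrite // /y0 -iterD subnK // ltnW.
  have all_y0 : forall y, conn p y0 y.
    apply: (@tau_indecomposable k N q.-1); first last.
    - move=> y y0y; rewrite prednK ?subn_gt0 //; apply: conn_trans y0q _.
      by elim: q => [|j IH] //=; exact: conn_tau.
    - by exists y0, 0 => //; exact: (leads_orbit 0).
    - by move=> y y' yy' [n pn ny]; exists n => //; exact: leads_window ny.
  by move=> y y'; apply: conn_trans (all_y0 y'); exact: conn_sym.
have [v [c [vx cx]]] := psi_recurrent k N x.
have cycles i : leads (i * c.+1) x x.
  elim: i => [|i IH]; first exact: leads_orbit.
  by rewrite mulSn; apply: leads_trans IH _; exists v.
have steps i : exists n, c.+1 %| n /\ leads n (iter i psi x) x'.
  by have [n ? ?] := conn_all c.+1 isT (iter i psi x) x'; exists n.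
have [f fP] := choice steps.
exists (\sum_(i < c.+1) (i + f i)) => n n_ge.
(* After [i] steps along the orbit of [x], a path of length divisible by [c.+1] completes the
   residue of [n]. *)
pose i := n %% c.+1; have i_lt : i < c.+1 by rewrite ltn_mod.
have [cf fx] := fP i.
have f_le : i + f i <= n.
  by apply: leq_trans n_ge; rewrite (bigD1 (Ordinal i_lt)) //= leq_addr.
have -> : n = f i + (i + (n - (i + f i))) by lia.
have /dvdnP[a ->] : c.+1 %| n - (i + f i).
  rewrite subnDA dvdn_sub //.
  by rewrite {1}(divn_eq n c.+1) addnK dvdn_mull.
exact: leads_trans (leads_trans (cycles a) (leads_orbit i x)) fx.
Qed.
End Mixing.
End Core.

(** * Two-sided gluing and duality *)

Section Resolving.
Local Open Scope nat_scope.
Variables (X : Type) (A : finType) (tau tau' psi psi' : X -> X) (P : X -> A).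
Hypotheses (tauK : cancel tau tau') (tauVK : cancel tau' tau).
Hypotheses (psiK : cancel psi psi') (psiVK : cancel psi' psi).
Hypothesis tau_psi : forall x, tau (psi x) = psi (tau x).

Lemma tauV_psi x : tau' (psi x) = psi (tau' x).
Proof. by rewrite -{1}(tauVK x) -tau_psi tauK. Qed.

Lemma tau_psiV x : tau (psi' x) = psi' (tau x).
Proof. by rewrite -{2}(psiVK x) tau_psi psiK. Qed.

Lemma tauV_psiV x : tau' (psi' x) = psi' (tau' x).
Proof. by rewrite -{2}(psiVK x) tauV_psi psiK. Qed.

Lemma iter_cancel_le j k x : j <= k ->
  iter (k - j) tau' (iter k tau x) = iter j tau x.
Proof. by move=> jk; rewrite -{2}(subnK jk) iterD (iter_cancel _ tauK). Qed.

Lemma iter_cancel_ge j k x : j <= k ->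
  iter k tau' (iter j tau x) = iter (k - j) tau' x.
Proof. by move=> jk; rewrite -{1}(subnK jk) iterD (iter_cancel _ tauK). Qed.

(* The pseudo-orbit is traced upwards: row [i.+1] keeps its right half and
   receives the left half of the image of row [i]. Anticipation by [psi] makes the
   next seam possible; by [psi'], it protects the left halves below. *)
Lemma agree_markov M M' s k :
  anticipates P tau psi M -> anticipates P tau' psi' M' ->
  glues P tau tau' s -> s <= k -> markov (agree P tau k) psi.
Proof.
move=> Ppsi PpsiV Pglue sk y py n.
(* [back] is agreement at all coordinates below [k], the side kept from the image of the row
   below. *)
pose back u v := forall j, P (iter j.+1 tau' (iter k tau u)) =
                           P (iter j.+1 tau' (iter k tau v)).
have back_agree u v : back u v -> agree P tau k u v.
  move=> uv j jk; have := uv (k - j.+1).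
  by rewrite subnSK // !iter_cancel_le // ltnW.
have back_psiV u v : back u v -> back (psi' u) (psi' v).
  have com w : iter k tau (psi' w) = psi' (iter k tau w).
    exact: (iter_tau_psi tau_psiV k 1 w).
  move=> uv j; rewrite !com !iterSr !tauV_psiV.
  by apply: (agree_forward_psi tauV_psiV PpsiV) => i; rewrite -!iterSr.
have step (p : nat * X) : exists z, agree_forward P tau p.2 (y p.1) ->
    agree_forward P tau z (y p.1.+1) /\ back z (psi p.2).
  have [fut|] := pselect (agree_forward P tau p.2 (y p.1)); last by exists p.2.
  have agr : agree P tau k (psi p.2) (y p.1.+1).
    move=> j jk; rewrite -(py p.1 j jk).
    exact: (agree_forward_psi tau_psi Ppsi fut j).
  have [z zy zp] := Pglue _ _ (fun j js => agr j (leq_trans js sk)).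
  exists z => _; split=> // j; have [jk|kj] := ltnP j k.
    have -> : j.+1 = k - (k - j.+1) by lia.
    by rewrite !iter_cancel_le ?leq_subr // zy agr //; lia.
  by rewrite !iter_cancel_ge 1?ltnW.
have [f fP] := choice step.
pose z := fix z i := if i is i'.+1 then f (i', z i') else y 0.
have zy i : agree_forward P tau (z i) (y i).
  by elim: i => [|i IH] //=; have [] := fP (i, z i) IH.
have mono e u v : back u v -> back (iter e psi' u) (iter e psi' v).
  by elim: e => [|e IH] uv //; apply: back_psiV; exact: IH.
(* Changes made at later rows, pulled back by [psi'], do not affect row [i] below coordinate [k]. *)
have zz d i : back (iter d psi' (z (d + i))) (z i).
  elim: d => [|d IH] // j.
  have base : back (psi' (z (d + i).+1)) (z (d + i)).
    rewrite -[z (d + i) in X in back _ X]psiK; apply: back_psiV.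
    by have [] := fP (_, _) (zy (d + i)).
  by rewrite -IH [iter d.+1 _ _]iterSr; exact: mono.
exists (iter n psi' (z n)) => i i_le j jk.
rewrite -(zy i j).
have := back_agree _ _ (zz (n - i) i) j jk; rewrite subnK // => <-.
by rewrite -{1}(subnKC i_le) iterD (iter_cancel _ psiVK).
Qed.

(** By [step] the column on the left is determined at depth [n], in the middle of the known rows;
    memorylessness of [psi] then determines it upwards to row [0]. *)
Lemma anticipates_dual M n k : 0 < k -> M <= k -> anticipates P tau psi M ->
  (forall x y, (forall c a, c < k -> a <= n.*2 ->
      P (iter c tau (iter a psi' x)) = P (iter c tau (iter a psi' y))) ->
    P (tau' (iter n psi' x)) = P (tau' (iter n psi' y))) ->
  anticipates (block P tau k) psi' tau' n.*2.
Proof.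
move=> k_gt0 Mk Ppsi step x y xy.
have {}xy c a : c < k -> a <= n.*2 ->
    P (iter c tau (iter a psi' x)) = P (iter c tau (iter a psi' y)).
  by move=> ck an; have /blockP := xy a an; exact.
have left_col i : i <= n -> P (tau' (iter (n - i) psi' x)) = P (tau' (iter (n - i) psi' y)).
  elim: i => [|i IH] i_le; first by rewrite subn0; exact: step.
  have psiE u : tau' (iter (n - i.+1) psi' u) = psi (tau' (iter (n - i) psi' u)).
    by rewrite -(subnSK i_le) /= tauV_psiV psiVK.
  rewrite !psiE; apply: Ppsi => -[|j] jM; first exact: IH (ltnW i_le).
  rewrite !iterSr !tauVK; apply: xy; first by rewrite (leq_trans _ Mk).
  by rewrite (leq_trans (leq_subr _ _)) // -addnn leq_addr.
apply/ffunP => -[[|c] ck]; rewrite !ffunE /=.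
  by have := left_col n (leqnn n); rewrite subnn.
rewrite -!iterS !iterSr !tauVK.
by apply: (xy c 0) => //; exact: ltnW.
Qed.
End Resolving.

Import Order.TTheory GRing.Theory Num.Theory.
Local Open Scope classical_set_scope.

(** * Locally constant maps and compactness *)

Section LocallyConstant.
Variable T : topologicalType.

(** Continuity for the discrete topology on [A]; for [A := Prop] it says that the set is clopen. *)
Definition loc_const (A : Type) (h : T -> A) := forall x, \forall y \near x, h y = h x.

Lemma loc_const_op (A B C : Type) (op : A -> B -> C) (f : T -> A) (g : T -> B) :
  loc_const f -> loc_const g -> loc_const (fun x => op (f x) (g x)).
Proof. by move=> cf cg x; apply: filterS2 (cf x) (cg x) => y -> ->. Qed.

Lemma loc_const_map (A B : Type) (op : A -> B) (f : T -> A) :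
  loc_const f -> loc_const (op \o f).
Proof. by move=> cf x; apply: filterS (cf x) => y /= ->. Qed.

Lemma loc_const_ffun (I : finType) (A : Type) (h : I -> T -> A) :
  (forall i, loc_const (h i)) -> loc_const (fun x => [ffun i => h i x]).
Proof.
move=> ch x; have H := filter_forall (nbhs_filter x) (fun i : I => ch i x).
by apply: filterS H => y /= hy; apply/ffunP => i; rewrite !ffunE hy.
Qed.

Lemma loc_const_forall (n : nat) (h : nat -> T -> Prop) :
  (forall i, (i < n)%N -> loc_const (h i)) ->
  loc_const (fun x => forall i, (i < n)%N -> h i x).
Proof.
move=> ch.
have := @loc_const_ffun 'I_n _ (fun i => h i) (fun i => ch i (ltn_ord i)).
move=> /(_ _)/filterS H x; apply: H => y /ffunP hy; apply/propext.
by split=> + i i_n => /(_ i i_n); have := hy (Ordinal i_n); rewrite !ffunE => ->.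
Qed.

Lemma loc_const_open (U : T -> Prop) : loc_const U -> open [set x | U x].
Proof. by move=> cU; rewrite openE => x /= Ux; apply: filterS (cU x) => y /= ->. Qed.

Lemma loc_const_closed (U : T -> Prop) : loc_const U -> closed [set x | U x].
Proof.
move=> cU; rewrite -[X in closed X]setCK; apply: open_closedC.
exact: (loc_const_open (loc_const_map not cU)).
Qed.

Lemma compact_nested (C : nat -> set T) : compact [set: T] ->
  (forall n, closed (C n)) -> (forall n, C n.+1 `<=` C n) ->
  (forall n, C n !=set0) -> exists x, forall n, C n x.
Proof.
move=> cT Cclosed Cdecr C0.
have Cle m n : (m <= n)%N -> C n `<=` C m.
  by move=> /subnK<-; elim: (n - m)%N => [|k IH] // x /Cdecr; exact: IH.
have FF : ProperFilter (filter_from [set: nat] C).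
  apply: filter_from_proper => [|n _]; last exact: C0.
  apply: filter_from_filter; first by exists 0%N.
  move=> m n _ _; exists (maxn m n) => // x Cx.
  by split; apply: Cle Cx; [exact: leq_maxl|exact: leq_maxr].
have [|x [_ clx]] := cT _ FF; first exact: filterT.
exists x => n; apply: Cclosed => B xB; apply: clx xB; by exists n.
Qed.
End LocallyConstant.

Lemma loc_const_comp (S T : topologicalType) (A : Type) (g : S -> T) (h : T -> A) :
  continuous g -> loc_const h -> loc_const (h \o g).
Proof. by move=> cg ch x; exact: cg (ch (g x)). Qed.

Lemma loc_const_pair (T : topologicalType) (A : Type) (h : T -> A) :
  loc_const h -> loc_const (fun p : T * T => h p.1 = h p.2).
Proof.
move=> ch; apply: loc_const_op.
- by apply: (loc_const_comp (g := fst)) ch => p; exact: cvg_fst.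
- by apply: (loc_const_comp (g := snd)) ch => p; exact: cvg_snd.
Qed.

Lemma continuous_iter (T : topologicalType) (f : T -> T) n :
  continuous f -> continuous (iter n f).
Proof.
move=> cf; elim: n => [|n IH] x; first exact: cvg_id.
by apply: continuous_comp; [exact: IH|exact: cf].
Qed.

Section CompactMetric.
Local Open Scope ring_scope.
Variables (R : realType) (X : metricType R).
Hypothesis X_compact : compact [set: X].

Lemma open_mdist_lt (e : R) : open [set p : X * X | mdist p.1 p.2 < e].
Proof.
rewrite openE => -[x y] /= xy; pose d := (e - mdist x y) / 2.
have d_gt0 : 0 < d by rewrite divr_gt0 // subr_gt0.
exists (ball x d, ball y d); first by split; exact: nbhsx_ballx.
move=> [x' y'] /= []; rewrite !ballEmdist /= => xx' yy'.
have := metric_triangle x' x y'; have := metric_triangle x y y'.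
rewrite (metric_sym x' x) /d in xx' yy' *; lra.
Qed.

Lemma closed_mdist_le (e : R) : closed [set p : X * X | mdist p.1 p.2 <= e].
Proof.
rewrite -[X in closed X]setCK; apply: open_closedC.
rewrite openE => -[x y] /= /negP; rewrite -ltNge => xy.
pose d := (mdist x y - e) / 2.
have d_gt0 : 0 < d by rewrite divr_gt0 // subr_gt0.
exists (ball x d, ball y d); first by split; exact: nbhsx_ballx.
move=> [x' y'] /= []; rewrite !ballEmdist /= => xx' yy'; apply/negP; rewrite -ltNge.
have := metric_triangle x x' y; have := metric_triangle x' y' y.
rewrite (metric_sym y' y) /d in xx' yy' *; lra.
Qed.

Lemma compact_pairs : compact [set: X * X].
Proof. by rewrite -setXTT; exact: compact_setX. Qed.

(** The source of the finite windows below: an implication from all levels of a decreasing sequence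
    of closed relations to an open relation already holds from some level. *)
Lemma compact_separation (S : nat -> X -> X -> Prop) (O : X -> X -> Prop) :
  (forall n, closed [set p : X * X | S n p.1 p.2]) ->
  open [set p : X * X | O p.1 p.2] ->
  (forall n x y, S n.+1 x y -> S n x y) ->
  (forall x y, (forall n, S n x y) -> O x y) ->
  exists n, forall x y, S n x y -> O x y.
Proof.
move=> cS oO Sdecr SO; apply: contrapT => /forallNP noS.
have [|||[x y] xy] := @compact_nested _
  (fun n => [set p : X * X | S n p.1 p.2] `&` ~` [set p : X * X | O p.1 p.2]) compact_pairs.
- by move=> n; apply: closedI => //; exact: open_closedC.
- by move=> n p [/Sdecr ? ?].
- by move=> n; have /existsNP[x /existsNP[y /not_implyP[? ?]]] := noS n; exists (x, y).
- by have [_ []] := xy 0%N; apply: SO => n; case: (xy n).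
Qed.

Lemma loc_const_uniform (A : Type) (h : X -> A) : loc_const h ->
  exists2 d : R, 0 < d & forall x y, mdist x y <= d -> h x = h y.
Proof.
move=> ch; pose S (n : nat) (x y : X) : Prop := mdist x y <= n.+1%:R^-1 :> R.
have [||||n nP] := @compact_separation S (fun x y => h x = h y).
- by move=> n; exact: closed_mdist_le.
- exact: loc_const_open (loc_const_pair ch).
- move=> n x y; rewrite /S => /le_trans; apply.
  by rewrite lef_pV2 ?posrE ?ltr0n // ler_nat.
- move=> x y xy; congr h; apply: mdist_positivity; apply/eqP.
  rewrite eq_le mdist_ge0 andbT; apply/ler_addgt0Pr => e e_gt0; rewrite add0r.
  have eV_ge0 : 0 <= e^-1 by rewrite invr_ge0 ltW.
  apply: le_trans (xy (Num.bound e^-1)) _.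
  rewrite -[leRHS]invrK lef_pV2 ?posrE ?invr_gt0 ?ltr0n //.
  by rewrite (le_trans (ltW (archi_boundP eV_ge0))) // ler_nat.
- by exists n.+1%:R^-1 => //; rewrite invr_gt0 ltr0n.
Qed.

End CompactMetric.

(** * Orbits of homeomorphisms and Markov partitions *)

Section HomeoIterates.
Variable X : topologicalType.
Implicit Types f g : homeo X.

Lemma homeo_expgE f n x : (f ^+ n)%g x = iter n f x.
Proof. by elim: n => [|n IH] //; rewrite expgS iterS -IH. Qed.

Lemma homeo_inv_expgE f n x : homeo_inv (f ^+ n)%g x = iter n (homeo_inv f) x.
Proof. by elim: n => [|n IH] //; rewrite expgSr iterS -IH. Qed.

Lemma homeo_exp_sub f (a b : nat) x :
  homeo_exp f (a%:Z - b%:Z)%R x = iter a f (iter b (homeo_inv f) x).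
Proof.
have [ba|/ltnW ab] := leqP b a.
  rewrite subzn //= homeo_expgE -{2}(subnK ba) iterD; congr (iter _ _ _).
  by rewrite (iter_cancel _ (homeo_invK f)).
case: (ltnP a b) => [a_lt|b_le].
  have -> : (a%:Z - b%:Z)%R = Negz (b - a).-1 by lia.
  rewrite /= [LHS](homeo_inv_expgE f _ x) prednK ?subn_gt0 //.
  by rewrite -{2}(subnKC ab) iterD (iter_cancel _ (homeo_invK f)).
have -> : b = a by lia.
by rewrite subrr (iter_cancel _ (homeo_invK f)).
Qed.

Lemma homeo_exp_split f (i : int) : exists a b : nat, (i = a%:Z - b%:Z)%R /\
  forall x, homeo_exp f i x = iter a f (iter b (homeo_inv f) x).
Proof.
have [a [b ->]] : exists a b : nat, (i = a%:Z - b%:Z)%R.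
  by case: i => n; [exists n, 0%N; lia | exists 0%N, n.+1; lia].
by exists a, b; split => // x; exact: homeo_exp_sub.
Qed.

Lemma homeo_expS f (i : int) x : homeo_exp f (i + 1)%R x = f (homeo_exp f i x).
Proof.
have [a [b [-> E]]] := homeo_exp_split f i.
have -> : (a%:Z - b%:Z + 1)%R = (a.+1%:Z - b%:Z)%R by lia.
by rewrite E homeo_exp_sub.
Qed.

Lemma homeo_expD f (i j : int) x :
  homeo_exp f (i + j)%R x = homeo_exp f i (homeo_exp f j x).
Proof.
have [a [b [-> ->]]] := homeo_exp_split f i; have [c [d [-> ->]]] := homeo_exp_split f j.
have -> : (a%:Z - b%:Z + (c%:Z - d%:Z))%R = ((a + c)%N%:Z - (b + d)%N%:Z)%R by lia.
have com y : homeo_inv f (f y) = f (homeo_inv f y) by rewrite homeo_funK homeo_invK.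
by rewrite homeo_exp_sub !iterD (iter_tau_psi com).
Qed.

Lemma homeo_exp_nat f (n : nat) x : homeo_exp f n x = iter n f x.
Proof. exact: homeo_expgE. Qed.

Lemma homeo_exp_natV f (n : nat) x :
  homeo_exp f (- n%:Z)%R x = iter n (homeo_inv f) x.
Proof. by rewrite -[(- _)%R]add0r (homeo_exp_sub f 0). Qed.

Lemma homeo_expK f (i : int) : cancel (homeo_exp f i) (homeo_exp f (- i)%R).
Proof. by move=> x; rewrite -homeo_expD addNr. Qed.

Lemma homeo_exp_com f g : (forall x, f (g x) = g (f x)) -> forall (i j : int) x,
  homeo_exp f i (homeo_exp g j x) = homeo_exp g j (homeo_exp f i x).
Proof.
move=> fg i j x; have fK := homeo_funK f; have fVK := homeo_invK f.
have gK := homeo_funK g; have gVK := homeo_invK g.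
have [a [b [-> iE]]] := homeo_exp_split f i; have [c [d [-> jE]]] := homeo_exp_split g j.
rewrite !iE !jE (iter_tau_psi (tauV_psi fK fVK fg)) (iter_tau_psi fg).
by rewrite (iter_tau_psi (tauV_psiV fK fVK gK gVK fg)) (iter_tau_psi (tau_psiV gK gVK fg)).
Qed.

Lemma homeo_expVE f (i : int) x : homeo_exp (homeo_invg f) i x = homeo_exp f (- i)%R x.
Proof.
have [a [b [-> ->]]] := homeo_exp_split (homeo_invg f) i.
rewrite opprB homeo_exp_sub /=.
by apply: iter_tau_psi => y; rewrite homeo_funK homeo_invK.
Qed.

Definition generating (A : Type) (P : X -> A) f := forall x y,
  (forall i, P (homeo_exp f i x) = P (homeo_exp f i y)) -> x = y.

Lemma generating_inv (A : Type) (P : X -> A) f :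
  generating P f -> generating P (homeo_invg f).
Proof.
move=> gP x y xy; apply: gP => i.
by have := xy (- i)%R; rewrite !homeo_expVE opprK.
Qed.

Lemma commute_fun f g : commute f g -> forall x, f (g x) = g (f x).
Proof. by move=> /(congr1 (@homeo_fun X X)) fg x; exact: (congr1 (fun h => h x) fg). Qed.
End HomeoIterates.

Section MarkovPartitions.
Variables (R : realType) (X : metricType R).
Implicit Types f tau psi : homeo X.

Definition kernel (B : Type) (kappa : X -> B) x y := kappa x = kappa y.

(** Arbitrarily fine clopen Markov partitions. *)
Definition markov_basis f := forall e : R, (0 < e)%R ->
  exists (B : finType) (kappa : X -> B), [/\ loc_const kappa,
    forall x y, kappa x = kappa y -> (mdist x y < e)%R & markov (kernel kappa) f].

(* Local product structure: nearby points have a common point on the local stable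
   set of one and the local unstable set of the other. *)
Definition product_structure f := forall e : R, (0 < e)%R ->
  exists2 d : R, (0 < d)%R & forall x y, (mdist x y <= d)%R ->
  exists w, (forall n, (mdist (iter n f w) (iter n f y) < e)%R) /\
    (forall n, (mdist (iter n (homeo_inv f) w) (iter n (homeo_inv f) x) < e)%R).

Hypothesis X_compact : compact [set: X].

Lemma iter_homeo_continuous f n : continuous (iter n f).
Proof. exact: continuous_iter (@homeo_fun_continuous _ _ f). Qed.

Lemma iter_homeoV_continuous f n : continuous (iter n (homeo_inv f)).
Proof. exact: continuous_iter (@homeo_inv_continuous _ _ f). Qed.

Lemma iter_homeoK f n : cancel (iter n f) (iter n (homeo_inv f)).
Proof. exact: iter_cancel (homeo_funK f). Qed.

Lemma iter_homeoVK f n : cancel (iter n (homeo_inv f)) (iter n f).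
Proof. exact: iter_cancel (homeo_invK f). Qed.

Lemma loc_const_orbit (A : Type) (P : X -> A) f a b :
  loc_const P -> loc_const (fun x => P (iter a f (iter b (homeo_inv f) x))).
Proof.
apply: (loc_const_comp (g := iter a f \o iter b (homeo_inv f))) => x.
apply: continuous_comp; first exact: iter_homeoV_continuous.
exact: iter_homeo_continuous.
Qed.

Lemma loc_const_block (A : finType) (P : X -> A) f k :
  loc_const P -> loc_const (block P f k).
Proof. by move=> cP; apply: loc_const_ffun => j; exact: (loc_const_orbit f j 0). Qed.

(** The points tracing [y] on [[-n, n]] form nested nonempty closed sets, so compactness gives one
    for all times. *)
Lemma markov_trace (B : finType) (kappa : X -> B) f (y : int -> X) :
  loc_const kappa -> markov (kernel kappa) f ->
  (forall i, kappa (f (y i)) = kappa (y (i + 1)%R)) ->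
  exists x, forall i, kappa (homeo_exp f i x) = kappa (y i).
Proof.
move=> ck mk py.
pose C n := [set x | forall i, (i < n.*2.+1)%N ->
  kappa (iter i f (iter n (homeo_inv f) x)) = kappa (y (i%:Z - n%:Z)%R)].
have [|||x xC] := @compact_nested _ C X_compact.
- move=> n; apply: loc_const_closed; apply: loc_const_forall => i _.
  apply: (loc_const_map (fun b => b = kappa (y (i%:Z - n%:Z)%R))).
  exact: loc_const_orbit.
- move=> n x /= xC i i_n; have := xC i.+1; rewrite iterSr [iter n.+1 _ _]iterS homeo_invK => -> //.
    by congr (kappa (y _)); lia.
  by rewrite doubleS ltnS ltnW.
- move=> n; have py' : pseudo_orbit (kernel kappa) f (fun i => y (i%:Z - n%:Z)%R).
    by move=> i; rewrite /kernel py; congr (kappa (y _)); lia.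
  have [w wP] := mk _ py' n.*2.
  exists (iter n f w) => i; rewrite ltnS => i_n; rewrite iter_homeoK.
  exact: wP.
exists x => i; have -> : (i = (absz (i + `|i|%N%:Z))%:Z - `|i|%N%:Z)%R by lia.
by rewrite homeo_exp_sub xC //; lia.
Qed.

Lemma markov_reverse (B : Type) (kappa : X -> B) f :
  markov (kernel kappa) (homeo_invg f) -> markov (kernel kappa) f.
Proof.
move=> mk y py n.
(* Read backwards, the image [f (y i)] has to replace [y i.+1]: it lies in the same fibre, and its
   preimage is exactly [y i]. *)
pose z i := if (i < n)%N then f (y (n - i).-1) else iter (i - n) (homeo_inv f) (y 0%N).
have zE i : (i <= n)%N -> kappa (z (n - i)%N) = kappa (y i).
  case: i => [|i] i_n; first by rewrite subn0 /z ltnn subnn.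
  have -> : z (n - i.+1)%N = f (y i).
    by rewrite /z ifT ?subKn //; lia.
  exact: py.
have [|w wz] := mk z _ n.
  move=> i; rewrite /kernel /=; have [i_n|n_i] := ltnP i n; last first.
    by rewrite /z ltnNge n_i /= ltnNge leqW // subSn.
  rewrite {1}/z i_n homeo_funK; have -> : i.+1 = (n - (n - i).-1)%N by lia.
  by rewrite zE //; lia.
exists (iter n (homeo_inv f) w) => i i_n.
rewrite /kernel -zE // -[RHS](wz (n - i)%N) ?leq_subr //.
by rewrite -{1}(subnKC i_n) iterD iter_homeoVK.
Qed.

Lemma markov_basis_inv f : markov_basis (homeo_invg f) -> markov_basis f.
Proof.
move=> mb e /mb[B [kappa [ck fine mk]]]; exists B, kappa; split=> //.
exact: markov_reverse.
Qed.

Lemma product_structure_inv f : product_structure f -> product_structure (homeo_invg f).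
Proof.
move=> ps e /ps[d d_gt0 dP]; exists d => // x y xy.
by have [|w [wy wx]] := dP y x; [rewrite metric_sym|exists w].
Qed.

Lemma markov_basis_potp f : markov_basis f -> POTP f.
Proof.
move=> mb e e_gt0; have [B [kappa [ck fine mk]]] := mb _ e_gt0.
have [d d_gt0 dk] := loc_const_uniform X_compact ck.
exists d => // y py.
have [x xy] := markov_trace ck mk (fun i => dk _ _ (py i)).
exists (fun i => homeo_exp f i x) => i; first exact: homeo_expS.
exact: fine.
Qed.

(** Trace the pseudo-orbit that follows the past of [x] and jumps to [y] at time [0]. *)
Lemma markov_basis_product f : markov_basis f -> product_structure f.
Proof.
move=> mb e e_gt0; have [B [kappa [ck fine mk]]] := mb _ e_gt0.
have [d d_gt0 dk] := loc_const_uniform X_compact ck.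
exists d => // x y xy.
pose z (i : int) := if (i < 0)%R then homeo_exp f i x else homeo_exp f i y.
have [|w wz] := @markov_trace _ _ _ z ck mk.
  move=> i; rewrite /z; case: (ltP i 0%R) => [i_lt|i_ge].
    rewrite -homeo_expS; case: ltP => // i_ge.
    have -> : (i + 1 = 0)%R by lia.
    exact: dk.
  by rewrite -homeo_expS ltNge; have -> : (0 <= i + 1)%R by lia.
exists w; split=> n; apply: fine.
  have n_ge0 : (n%:Z - 0%:Z < 0)%R = false by lia.
  by have := wz (n%:Z - 0%:Z)%R; rewrite /z n_ge0 !homeo_exp_sub.
have := wz (0%:Z - n%:Z)%R; rewrite /z.
case: n => [|n]; last first.
  have n_lt0 : (0%:Z - n.+1%:Z < 0)%R by lia.
  by rewrite n_lt0 !homeo_exp_sub.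
by rewrite subrr /= => ->; apply/esym/dk.
Qed.

Lemma generating_separates (A : Type) (P : X -> A) tau (e : R) :
  loc_const P -> generating P tau -> (0 < e)%R -> exists n, forall x y,
    agree P tau n.*2.+1 (iter n (homeo_inv tau) x) (iter n (homeo_inv tau) y) ->
    (mdist x y < e)%R.
Proof.
move=> cP gP e_gt0.
pose S n x y := agree P tau n.*2.+1 (iter n (homeo_inv tau) x) (iter n (homeo_inv tau) y).
apply: (@compact_separation _ _ X_compact S) => [n|| n x y xy i i_n|x y xy].
- apply: loc_const_closed; apply: loc_const_forall => i _.
  exact: (loc_const_pair (loc_const_orbit tau i n cP)).
- exact: open_mdist_lt.
- have := xy i.+1; rewrite !(iterSr i) !(iterS n) !homeo_invK; apply.
  by rewrite doubleS ltnS ltnW.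
- have -> : x = y; last by rewrite mdistxx.
  apply: gP => i; have -> : (i = (absz (i + `|i|%N%:Z))%:Z - `|i|%N%:Z)%R by lia.
  by rewrite !homeo_exp_sub; apply: xy; lia.
Qed.

(** Agreement on [l.*2.+1] letters makes the points shifted by [l] close. Their common point has its
    seam at [l], and shifting back leaves it unchanged that [x] and [y] agree between [0] and
    [l]. *)
Lemma product_structure_glues (A : Type) (P : X -> A) tau :
  loc_const P -> generating P tau -> product_structure tau ->
  exists s, glues P tau (homeo_inv tau) s.
Proof.
move=> cP gP ps; have [e e_gt0 eP] := loc_const_uniform X_compact cP.
have [d d_gt0 dP] := ps _ e_gt0.
have [l lP] := generating_separates cP gP d_gt0.
exists l.*2.+1 => x y xy.
have [|w [wy wx]] := dP (iter l tau x) (iter l tau y).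
  by apply/ltW/lP; rewrite !iter_homeoK.
have {}wy n := eP _ _ (ltW (wy n)); have {}wx n := eP _ _ (ltW (wx n)).
exists (iter l (homeo_inv tau) w) => j; last first.
  by rewrite -iterD wx iterD iter_homeoK.
have [jl|lj] := leqP l j.
  by rewrite -(subnK jl) iterD iter_homeoVK wy -iterD.
have subE u : iter j tau (iter l (homeo_inv tau) u) = iter (l - j) (homeo_inv tau) u.
  by rewrite -{1}(subnKC (ltnW lj)) iterD iter_homeoVK.
rewrite subE wx (iter_cancel_le (homeo_funK tau) _ (ltnW lj)).
by apply: xy; rewrite -addnn ltnS (leq_trans (ltnW lj)) ?leq_addr.
Qed.

End MarkovPartitions.

(** * One-sided expansive memoryless automorphisms *)

Section OneSidedExpansive.
Variables (R : realType) (X : metricType R).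
Hypothesis X_compact : compact [set: X].
Variables (tau psi : homeo X) (A : finType) (P : X -> A).
Hypotheses (P_const : loc_const P) (P_gen : generating P tau).
Let tau' := homeo_inv tau.
Let psi' := homeo_inv psi.

Let tauK : cancel tau tau' := homeo_funK tau.
Let tauVK : cancel tau' tau := homeo_invK tau.
Let psiK : cancel psi psi' := homeo_funK psi.
Let psiVK : cancel psi' psi := homeo_invK psi.

Lemma cell_const c a : loc_const (cell tau psi P c a).
Proof.
apply: (loc_const_comp (g := iter c tau \o iter a psi)) P_const.
by move=> x; apply: continuous_comp; exact: iter_homeo_continuous.
Qed.

Lemma win_const k N : loc_const (win tau psi P k N).
Proof. by apply: loc_const_ffun => c; exact: cell_const. Qed.

(** Mixing gives a point [u] returning to its block after [p] steps. Repeating this segment gives a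
    periodic pseudo-orbit; the traced point is periodic since [P] is generating. *)
Lemma periodic_point (s K : nat) (x : X) :
  glues P tau tau' s -> topologically_mixing tau ->
  exists y p, [/\ (0 < p)%N, agree P tau K y x & iter p tau y = y].
Proof.
move=> Pglue mix; pose K' := (maxn K s).+1.
have step1 f : anticipates P f f 1 by move=> u v uv; exact: (uv 1%N).
have mk : markov (agree P tau K') tau.
  apply: (agree_markov tauK tauVK tauK tauVK (fun=> erefl)
    (step1 tau) (step1 tau') Pglue).
  exact: leqW (leq_maxr _ _).
pose kappa := block P tau K'.
have kappa_const : loc_const kappa by exact: loc_const_block.
have mkk : markov (kernel kappa) tau.
  move=> y py n; have [|w wP] := mk y _ n; first by move=> i; exact/blockP/py.
  by exists w => i i_n; exact/blockP/wP.
pose U := [set u | kappa u = kappa x].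
have oU : open U.
  by apply: loc_const_open; exact: (loc_const_map (fun b => b = kappa x) kappa_const).
have [N NP] := mix U U oU oU (ex_intro _ x erefl) (ex_intro _ x erefl).
have [_ [[u Uu <-] Upu]] := NP N.+1 (leqnSn N).
pose p := N.+1; pose z (i : int) := iter `|(i %% p)%Z|%N tau u.
have zp i : z (i + p%:Z)%R = z i by rewrite /z modzDr.
have z_pseudo i : kappa (tau (z i)) = kappa (z (i + 1)%R).
  have p_neq0 : (p%:Z != 0)%R by [].
  have := modz_ge0 i p_neq0; have := ltz_pmod i (isT : (0 < p%:Z)%R).
  rewrite /z -modzDml; case: (i %% p)%Z => // m; rewrite ltz_nat absz_nat => mp _.
  have [Sm_lt|Sm_ge] := ltnP m.+1 p.
    by rewrite modz_small /= ?addn1 //; lia.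
  have -> : (m%:Z + 1 = p%:Z)%R by lia.
  have mE : m = N by lia.
  by rewrite modzz /= mE -iterS Upu Uu.
have [y yz] := markov_trace X_compact kappa_const mkk z_pseudo.
exists y, p; split=> //.
  move=> j jK; have /blockP := yz 0%R; rewrite /z mod0z /= => yu.
  have jK' : (j < K')%N by rewrite ltnS (leq_trans (ltnW jK)) ?leq_maxl.
  by rewrite yu //; have /blockP := Uu; apply.
apply: P_gen => i; rewrite -(homeo_exp_nat tau) -homeo_expD.
have /blockP/(_ 0%N (ltn0Sn _)) /= -> := yz (i + p%:Z)%R.
by rewrite zp; have /blockP/(_ 0%N (ltn0Sn _)) /= -> := yz i.
Qed.

Section Recurrence.
Hypothesis tau_psi : forall x, tau (psi x) = psi (tau x).
Variables (M s : nat).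
Hypotheses (P_ant : anticipates P tau psi M) (P_glues : glues P tau tau' s).
Hypothesis tau_mixing : topologically_mixing tau.

(** The points fixed by [iter p tau] are determined by [p] letters, so they are finitely many, and
    [psi] permutes them. *)
Lemma psi_periodic y p : (0 < p)%N -> iter p tau y = y ->
  exists2 q, (0 < q)%N & iter q psi y = y.
Proof.
move=> p_gt0 yp.
have fix_psi i : iter p tau (iter i psi y) = iter i psi y.
  by rewrite (iter_tau_psi tau_psi) yp.
pose h (i : 'I_#|{ffun 'I_p -> A}|.+1) := block P tau p (iter i psi y).
have /injectivePn[i [i' ii' hi]] : ~~ injectiveb h.
  by apply/injectiveP => /leq_card; rewrite card_ord ltnn.
have {ii' hi} [i0 [i1 [i01 hi]]] : exists i0 i1, (i0 < i1)%N /\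
    agree P tau p (iter i0 psi y) (iter i1 psi y).
  have /blockP hE : block P tau p (iter i psi y) = block P tau p (iter i' psi y) by [].
  have [i_lt|i_gt|/val_inj i_eq] := ltngtP i i'; [by exists i, i'| |by rewrite i_eq eqxx in ii'].
  by exists i', i; split=> // j jp; rewrite hE.
have same : iter i0 psi y = iter i1 psi y.
  apply: P_gen => i2; have [a [b [_ E]]] := homeo_exp_split tau i2; rewrite !{}E.
  have red u : iter p tau u = u ->
      iter a tau (iter b tau' u) = iter ((a + b * p.-1) %% p) tau u.
    move=> up; have umul c : iter (c * p) tau u = u.
      by elim: c => [|c IH] //; rewrite mulSn iterD IH.
    have -> : iter b tau' u = iter (b * p.-1) tau u.
      rewrite -{1}(umul b) -{1}(prednK p_gt0) mulnS iterD.
      exact: iter_homeoK.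
    by rewrite -iterD {1}(divn_eq (a + _) p) addnC iterD umul.
  by rewrite !red // hi // ltn_mod.
exists (i1 - i0)%N; first by rewrite subn_gt0.
apply: (can_inj (iter_cancel i0 psiK)).
by rewrite -iterD subnKC ?(ltnW i01) // same.
Qed.

Lemma psi_recurrent k N x : exists y n,
  window tau psi P k N y x /\ window tau psi P k N (iter n.+1 psi y) x.
Proof.
have [y [p [p_gt0 yx yp]]] := periodic_point (k + M * N) x P_glues tau_mixing.
have [[|q] // _ yq] := psi_periodic p_gt0 yp.
by exists y, q; rewrite yq; split; exact: agree_window tau_psi _ P_ant _ _ _ _ yx.
Qed.

Lemma tau_indecomposable k N q (U : X -> Prop) :
  (forall x y, window tau psi P k N x y -> U x -> U y) ->
  (exists x, U x) -> (forall x, U x -> U (iter q.+1 tau x)) -> forall x, U x.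
Proof.
move=> U_win [u Uu] U_tau; apply: contrapT => /existsNP[v nUv].
have cU : loc_const U.
  move=> x; apply: filterS (@win_const k N x) => y /winP yx; apply/propext.
  by split; apply: U_win => //; exact: window_sym.
have [n nP] := tau_mixing (loc_const_open cU) (loc_const_open (loc_const_map not cU))
  (ex_intro _ u Uu) (ex_intro _ v nUv).
have [_ [[x /= Ux <-] nUx]] := nP (n * q.+1)%N (leq_pmulr _ (ltn0Sn _)).
apply: nUx; elim: (n) => [|m IH] //.
by rewrite mulSn iterD; exact: U_tau.
Qed.

Hypothesis psi_expansive : left_expansive tau psi.

Lemma left_expansive_cells x y :
  (forall i j : int, (j <= 0)%R ->
    P (homeo_exp psi i (homeo_exp tau j x)) = P (homeo_exp psi i (homeo_exp tau j y))) ->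
  x = y.
Proof.
move=> xy; have [d d_gt0 dP] := psi_expansive.
have [n nP] := generating_separates X_compact P_const P_gen d_gt0.
(* Translation by [-n] moves the columns that control the distance into the half-plane of columns
   [<= 0]. *)
apply: (can_inj (homeo_expK tau (- n%:Z)%R)); apply: dP => i j j_le0.
apply/ltW/nP => c c_le.
rewrite -!homeo_exp_sub -!(homeo_exp_com tau_psi) -!homeo_expD !(homeo_exp_com tau_psi).
by apply: xy; lia.
Qed.

Lemma cell_shift c a n x : cell tau psi P c a (iter n tau' (iter n psi' x)) =
  P (homeo_exp psi (a%:Z - n%:Z)%R (homeo_exp tau (c%:Z - n%:Z)%R x)).
Proof.
rewrite /cell -!homeo_exp_natV -(homeo_exp_nat psi) -(homeo_exp_nat tau).
by rewrite -(homeo_exp_com tau_psi) -homeo_expD -homeo_expD (homeo_exp_com tau_psi).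
Qed.

(** The columns [<= 0] determine the point and hence column [1]. By compactness columns [-n, ..., 0]
    and rows [-n, ..., n] suffice; [g n] translates them to nonnegative indices. *)
Lemma window_determines : exists k0 r, forall x y,
  window tau psi P k0 r.*2 x y -> cell tau psi P k0 r x = cell tau psi P k0 r y.
Proof.
pose g n x := iter n tau' (iter n psi' x).
pose S n x y := forall c, (c < n.+1)%N -> forall a, (a < n.*2.+1)%N ->
  cell tau psi P c a (g n x) = cell tau psi P c a (g n y).
have [|||x y xy|n nP] := @compact_separation _ _ X_compact S
    (fun x y => P (tau x) = P (tau y)).
- move=> n; apply: loc_const_closed; apply: loc_const_forall => c _.
  apply: loc_const_forall => a _.
  apply: (loc_const_pair (h := cell tau psi P c a \o g n)).
  apply: loc_const_comp (cell_const c a) => x.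
  by apply: continuous_comp; exact: iter_homeoV_continuous.
- apply: loc_const_open; apply: (loc_const_pair (h := P \o tau)).
  exact: loc_const_comp (@homeo_fun_continuous _ _ tau) P_const.
- move=> n x y xy c cn a an; have := xy c.+1 cn a.+1; rewrite !cell_shift.
  have -> : (c.+1%:Z - n.+1%:Z = c%:Z - n%:Z)%R by lia.
  have -> : (a.+1%:Z - n.+1%:Z = a%:Z - n%:Z)%R by lia.
  by apply; lia.
- congr (P (tau _)); apply: left_expansive_cells => i j j_le0.
  pose n := (`|i| + `|j|)%N.
  have := xy n (absz (n%:Z + j)%R) _ (absz (n%:Z + i)%R) _; rewrite !cell_shift.
  have -> : ((absz (n%:Z + j))%:Z - n%:Z = j)%R by rewrite /n; lia.
  have -> : ((absz (n%:Z + i))%:Z - n%:Z = i)%R by rewrite /n; lia.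
  by apply; rewrite /n; lia.
exists n.+1, n => x y xy.
have gK u : g n (iter n psi (iter n tau u)) = u.
  by rewrite /g (iter_homeoK psi) (iter_homeoK tau).
have := nP (iter n psi (iter n tau x)) (iter n psi (iter n tau y)).
rewrite /S /cell /= !(iter_tau_psi tau_psi); apply=> c cn a an.
by rewrite !gK; exact: xy.
Qed.

Lemma win_fine (e : R) : (0 < e)%R -> exists n, forall k N x y, (n.*2 < k)%N ->
  win tau psi P k N (iter n tau' x) = win tau psi P k N (iter n tau' y) ->
  (mdist x y < e)%R.
Proof.
move=> e_gt0; have [n nP] := generating_separates X_compact P_const P_gen e_gt0.
exists n => k N x y kn /winP xy; apply: nP => j jn.
by apply: (xy j 0%N) => //; exact: leq_trans kn.
Qed.

Lemma psi_iter_conj m n x : iter m tau' (iter n psi (iter m tau x)) = iter n psi x.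
Proof. by rewrite -(iter_tau_psi tau_psi) (iter_homeoK tau). Qed.

Theorem one_sided_expansive : markov_basis psi /\ topologically_mixing psi.
Proof.
have [k0 [r expands]] := window_determines.
(* The first summand makes the windows fine; the others provide the widths required by
   [window_markov] and [window_leads]. *)
pose k n := (n.*2.+1 + (k0 + (s + M)))%N.
have kn n : (n.*2 < k n)%N by rewrite /k; lia.
have k0k n : (k0 <= k n)%N by rewrite /k; lia.
have sk n : (s <= k n)%N by rewrite /k; lia.
have Mk n : (M <= k n)%N by rewrite /k; lia.
split=> [e e_gt0|U V oU oV [u Uu] [v Vv]].
  have [n nP] := win_fine e_gt0.
  exists {ffun 'I_(k n) * 'I_r.*2.+1 -> A}, (win tau psi P (k n) r.*2 \o iter n tau'); split.
  - by apply: (loc_const_comp (g := iter n tau'));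
      [exact: iter_homeoV_continuous|exact: win_const].
  - by move=> x y; apply: nP.
  move=> y py m.
  have := window_markov tauK tauVK psiVK tau_psi P_ant P_glues expands
    psi_recurrent tau_indecomposable (k0k n) (leqnn _) (sk n) (Mk n).
  move=> /(_ (fun i => iter n tau' (y i)) _ m)[|w wP].
    move=> i; apply/winP; have := py i; rewrite /kernel /= => <-; congr win.
    exact/esym/(iter_tau_psi (tauV_psi tauK tauVK tau_psi) n 1).
  exists (iter n tau w) => i i_m; rewrite /kernel /= psi_iter_conj.
  exact/winP/wP.
have ball_in (W : set X) x : open W -> W x ->
    exists2 d : R, (0 < d)%R & forall y, (mdist y x < d)%R -> W y.
  rewrite openE => oW /oW; rewrite /interior -nbhs_ballE => -[d /= d_gt0 dW].
  by exists d => // y yx; apply: dW; rewrite ballEmdist /= metric_sym.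
have [d d_gt0 uU] := ball_in U u oU Uu; have [d' d'_gt0 vV] := ball_in V v oV Vv.
have [n nP] : exists n, forall N x y, win tau psi P (k n) N (iter n tau' x) =
    win tau psi P (k n) N (iter n tau' y) -> (mdist x y < Num.min d d')%R.
  have [|n nP] := win_fine (e := Num.min d d'); first by rewrite lt_min d_gt0.
  by exists n => N x y; exact: nP.
have [n0 n0P] := window_leads tauK tauVK psiVK tau_psi P_ant P_glues expands
  psi_recurrent tau_indecomposable (k0k n) (leqnn _) (sk n) (Mk n)
  (iter n tau' u) (iter n tau' v).
exists n0 => m /n0P[w /winP wu /winP wv].
exists (iter m psi (iter n tau w)); split.
  exists (iter n tau w) => //; apply: uU; apply: lt_le_trans (nP r.*2 _ _ _) _.
    by rewrite (iter_homeoK tau).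
  by rewrite ge_min lexx.
apply: vV; apply: lt_le_trans (nP r.*2 _ _ _) _; first by rewrite psi_iter_conj.
by rewrite ge_min lexx orbT.
Qed.
End Recurrence.
End OneSidedExpansive.

(** * Exchanging the roles of the two automorphisms *)

Section Duality.
Variables (R : realType) (X : metricType R).
Implicit Types tau psi : homeo X.
Hypothesis X_compact : compact [set: X].

Definition anticipating tau psi := (forall x, tau (psi x) = psi (tau x)) /\
  exists (A : finType) (P : X -> A) (M : nat),
    [/\ loc_const P, generating P tau & anticipates P tau psi M].

(** A coordinate-free substitute for being a mixing SFT, suited to chains in which every link has
    its own coordinates. *)
Definition mixing_product tau := product_structure tau /\ topologically_mixing tau.

Lemma expansive_left tau psi : expansive psi -> left_expansive tau psi.
Proof.
by move=> [d d_gt0 dP]; exists d => // x y xy; apply: dP => i; exact: (xy i 0%R).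
Qed.

Lemma expansive_inv psi : expansive psi -> expansive (homeo_invg psi).
Proof.
move=> [d d_gt0 dP]; exists d => // x y xy; apply: dP => i.
by have := xy (- i)%R; rewrite !homeo_expVE opprK.
Qed.

Lemma left_expansive_inv tau psi :
  right_expansive tau psi -> left_expansive (homeo_invg tau) (homeo_invg psi).
Proof.
move=> [d d_gt0 dP]; exists d => // x y xy; apply: dP => i j j_ge0.
have := xy (- i)%R (- j)%R; rewrite !homeo_expVE !opprK oppr_le0; exact.
Qed.

Lemma mixing_inv psi : topologically_mixing psi -> topologically_mixing (homeo_invg psi).
Proof.
move=> mix U V oU oV U0 V0; have [N NP] := mix V U oV oU V0 U0.
exists N => n /NP[_ [[v Vv <-] Uv]]; exists v; split=> //.
by exists (iter n psi v) => //; exact: (iter_homeoK psi).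
Qed.

Lemma mixing_product_inv psi : mixing_product psi -> mixing_product (homeo_invg psi).
Proof. by case=> ? ?; split; [exact: product_structure_inv|exact: mixing_inv]. Qed.

Lemma one_sided_expansive_markov tau psi : mixing_product tau -> anticipating tau psi ->
  left_expansive tau psi -> markov_basis psi /\ topologically_mixing psi.
Proof.
move=> [ps mix] [com [A [P [M [cP gP Pant]]]]] le.
have [s Pglue] := product_structure_glues X_compact cP gP ps.
exact: (one_sided_expansive X_compact cP gP com Pant Pglue).
Qed.

(** By expansiveness of [psi] a vertical strip of [k] columns determines the point. By compactness a
    finite part of it determines the next cell on the left, as [anticipates_dual] requires. *)
Lemma anticipating_dual tau psi : anticipating tau psi -> expansive psi ->
  anticipating (homeo_invg psi) (homeo_invg tau).
Proof.
move=> [com [A [P [M [cP gP Pant]]]]] [d d_gt0 dP].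
have tauK := homeo_funK tau; have tauVK := homeo_invK tau.
have psiK := homeo_funK psi; have psiVK := homeo_invK psi.
split; first by move=> x /=; rewrite (tauV_psiV tauK tauVK psiK psiVK com).
have [n1 n1P] := generating_separates X_compact cP gP d_gt0.
(* The first summand separates points below the expansive constant of [psi]; [M] is the width needed
   for memorylessness. *)
pose k := (n1.*2.+1 + M)%N.
have strip x y : (forall (i : int) c, (c < k)%N ->
    P (iter c tau (homeo_exp psi i x)) = P (iter c tau (homeo_exp psi i y))) -> x = y.
  move=> xy; apply: (can_inj (iter_homeoK tau n1)); apply: dP => i.
  apply/ltW/n1P => c c_lt; rewrite -!(homeo_exp_nat tau) -!(homeo_exp_com com).
  rewrite !(homeo_exp_nat tau) !(iter_homeoK tau); apply: xy.
  by rewrite (leq_trans c_lt) // leq_addr.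
pose S n x y := forall c, (c < k)%N -> forall a, (a < n.*2.+1)%N ->
  P (iter c tau (homeo_exp psi (n%:Z - a%:Z)%R x)) =
  P (iter c tau (homeo_exp psi (n%:Z - a%:Z)%R y)).
have [|||x y xy|n nP] := @compact_separation _ _ X_compact S
    (fun x y => P (homeo_inv tau x) = P (homeo_inv tau y)).
- move=> n; apply: loc_const_closed; apply: loc_const_forall => c _.
  apply: loc_const_forall => a _.
  apply: (loc_const_pair (h := fun x => P (iter c tau (homeo_exp psi (n%:Z - a%:Z)%R x)))) => x.
  have := loc_const_orbit psi n a (loc_const_orbit tau c 0 cP) x.
  by apply: filterS => y; rewrite !homeo_exp_sub.
- apply: loc_const_open; apply: (loc_const_pair (h := P \o homeo_inv tau)).
  exact: loc_const_comp (@homeo_inv_continuous _ _ tau) cP.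
- move=> n x y xy c ck a an; have := xy c ck a.+1.
  have -> : (n.+1%:Z - a.+1%:Z = n%:Z - a%:Z)%R by lia.
  by apply; lia.
- congr (P (homeo_inv tau _)); apply: strip => i c ck.
  have := xy `|i|%N c ck (absz (`|i|%N%:Z - i)%R) _.
  have -> : (`|i|%N%:Z - (absz (`|i|%N%:Z - i))%:Z = i)%R by lia.
  by apply; lia.
exists {ffun 'I_k -> A}, (block P tau k), n.*2; split.
- exact: loc_const_block.
- by apply: generating_inv => x y xy; apply: strip => i; exact/blockP.
- apply: (anticipates_dual tauK tauVK psiK psiVK com _ _ Pant).
  + by rewrite /k addSn.
  + by rewrite /k leq_addl.
  move=> x y xy; apply: nP => c ck a an.
  rewrite -!homeo_exp_natV -!homeo_expD.
  have -> : (n%:Z - a%:Z + - n%:Z = - a%:Z)%R by lia.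
  by rewrite !homeo_exp_natV; apply: xy.
Qed.
End Duality.

(** * Subshifts *)

Section FullShift.
Variable A : finType.

Lemma coordinate_const (i : int) : loc_const (fun a : fullshift A => a i : A).
Proof.
move=> a; have ci : continuous (proj i : fullshift A -> discrete_topology A).
  exact: proj_continuous.
have := ci a [set a i]; rewrite /= => /(_ _).
by apply; exact: discrete_set1.
Qed.

Lemma fullshift_compact : compact [set: fullshift A].
Proof.
have := @tychonoff int (fun=> discrete_topology A) (fun=> setT).
have -> : [set f : forall i : int, discrete_topology A | forall i, setT (f i)] = setT.
  by apply/seteqP; split.
apply=> _; apply: finite_compact; exact: finite_finset.
Qed.
End FullShift.

Section Coordinates.
Variables (X : topologicalType) (A : finType) (S : subshift A).
Variables (tau : homeo X) (theta : homeomorphism X S).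
Hypothesis theta_tau : forall x, theta (tau x) = sigma (theta x).

Definition letter (x : X) : A := val (theta x) 0%R.

Lemma val_theta_continuous : continuous (fun x => val (theta x) : fullshift A).
Proof.
move=> x; apply: continuous_comp; first exact: homeo_fun_continuous.
exact: initial_continuous.
Qed.

Lemma letter_const : loc_const letter.
Proof.
exact: loc_const_comp val_theta_continuous (@coordinate_const A 0%R).
Qed.

Lemma theta_exp i j x :
  val (theta (homeo_exp tau i x)) j = val (theta x) (j + i)%R.
Proof.
have step y k : val (theta (tau y)) k = val (theta y) (k + 1)%R by rewrite theta_tau.
have stepV y k : val (theta (homeo_inv tau y)) k = val (theta y) (k - 1)%R.
  by have := step (homeo_inv tau y) (k - 1)%R; rewrite homeo_invK subrK => ->.
have [a [b [-> ->]]] := homeo_exp_split tau i.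
have backward k : val (theta (iter b (homeo_inv tau) x)) k = val (theta x) (k - b%:Z)%R.
  elim: b k => [|b IH] k; first by rewrite subr0.
  by rewrite iterS stepV IH; congr (val (theta x) _); lia.
elim: a j => [|a IH] j; first by rewrite backward; congr (val (theta x) _); lia.
by rewrite iterS step IH; congr (val (theta x) _); lia.
Qed.

Lemma letter_exp i x : letter (homeo_exp tau i x) = val (theta x) i.
Proof. by rewrite /letter theta_exp add0r. Qed.

Lemma letter_generating : generating letter tau.
Proof.
move=> x y xy; apply: (can_inj (homeo_funK theta)); apply: val_inj.
by apply/funext => i; rewrite -!letter_exp xy.
Qed.
End Coordinates.

Lemma finite_type_glue (A : finType) (S : subshift A) : finite_type S ->
  exists s : nat, forall a b : fullshift A, subshift_set S a -> subshift_set S b ->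
  (forall j, (0 <= j < s%:Z)%R -> a j = b j) ->
  exists c : fullshift A, [/\ subshift_set S c, forall j, (0 <= j)%R -> c j = b j &
    forall j, (j <= 0)%R -> c j = a j].
Proof.
(* A forbidden word starting at a negative index ends where the glued sequence still equals [a]; any
   other lies in [b]. The successor makes the overlap contain [0]. *)
move=> [F SF]; exists (\max_(w <- F) size w).+1 => a b Sa Sb ab.
pose c : fullshift A := fun j => if (j < 0)%R then a j else b j.
have cb j : (0 <= j)%R -> c j = b j by rewrite /c ltNge => ->.
have ca j : (j < (\max_(w <- F) size w).+1%:Z)%R -> c j = a j.
  by move=> j_lt; rewrite /c; case: (ltP j 0%R) => // j_ge0; rewrite (ab j) // j_ge0.
exists c; split => //; last by move=> j j_le0; rewrite ca //; lia.
rewrite SF => w wF [i iw].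
have w_le : (size w <= \max_(w <- F) size w)%N by exact: leq_bigmax_seq.
have [i_ge0|i_lt0] := leP 0%R i.
  rewrite SF in Sb; apply: (Sb w wF); exists i => k; rewrite iw cb //.
  by rewrite addr_ge0.
rewrite SF in Sa; apply: (Sa w wF); exists i => k; rewrite iw ca //.
have kw : (k < size w)%N := ltn_ord k.
move: (leq_trans kw w_le); set m := \max_(u <- F) _; lia.
Qed.

Lemma mixing_conjugate (X Y : topologicalType) (theta : homeomorphism X Y)
    (f : X -> X) (g : Y -> Y) :
  (forall x, theta (f x) = g (theta x)) ->
  topologically_mixing f -> topologically_mixing g.
Proof.
move=> fg mix U V oU oV [u Uu] [v Vv].
have /continuousP ctheta := @homeo_fun_continuous _ _ theta.
have [||N NP] := mix _ _ (ctheta _ oU) (ctheta _ oV).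
- by exists (homeo_inv theta u); rewrite /= homeo_invK.
- by exists (homeo_inv theta v); rewrite /= homeo_invK.
exists N => n /NP[_ [[x /= Ux <-] /= Vx]]; exists (theta (iter n f x)); split=> //.
by exists (theta x) => //; elim: (n) => [|m IH] //=; rewrite IH fg.
Qed.

(** * From mixing SFTs to local product structure *)

Section FromSFT.
Variables (R : realType) (X : metricType R).
Hypothesis X_compact : compact [set: X].
Variable tau : homeo X.

Lemma glues_product_structure (A : finType) (P : X -> A) (s : nat) :
  loc_const P -> generating P tau -> glues P tau (homeo_inv tau) s ->
  product_structure tau.
Proof.
move=> cP gP Pglue e e_gt0.
have [l lP] := generating_separates X_compact cP gP e_gt0.
(* [s] letters are needed to glue at [0], and radius [l] to control distances across the seam. *)
pose L := (l + s)%N.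
have [d d_gt0 dP] := loc_const_uniform X_compact
  (loc_const_comp (@iter_homeoV_continuous _ _ tau L) (loc_const_block tau L.*2.+1 cP)).
exists d => // x y /dP/blockP xy.
have {}xy (i : int) : (- L%:Z <= i <= L%:Z)%R -> P (homeo_exp tau i x) = P (homeo_exp tau i y).
  move=> iL; have j_lt : (absz (i + L%:Z)%R < L.*2.+1)%N by lia.
  have := xy _ j_lt; rewrite -!homeo_exp_sub.
  by have -> : ((absz (i + L%:Z))%:Z - L%:Z = i)%R by lia.
have [|w wy wx] := Pglue x y.
  by move=> j js; have := xy j; rewrite !homeo_exp_nat; apply; rewrite /L; lia.
have {}wy i : (0 <= i)%R -> P (homeo_exp tau i w) = P (homeo_exp tau i y).
  by case: i => // n _; rewrite !homeo_exp_nat.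
have {}wx i : (i <= 0)%R -> P (homeo_exp tau i w) = P (homeo_exp tau i x).
  move=> i_le0; have -> : (i = - `|i|%N%:Z)%R by lia.
  by rewrite !homeo_exp_natV.
have wy' i : (- L%:Z <= i)%R -> P (homeo_exp tau i w) = P (homeo_exp tau i y).
  move=> iL; have [i_ge0|i_lt0] := leP 0%R i; first exact: wy.
  by rewrite wx; [apply: xy|]; lia.
have wx' i : (i <= L%:Z)%R -> P (homeo_exp tau i w) = P (homeo_exp tau i x).
  move=> iL; have [i_ge0|i_lt0] := leP i 0%R; first exact: wx.
  by rewrite wy; [apply/esym/xy|]; lia.
exists w; split=> n; apply: lP => j j_lt.
  rewrite -!homeo_exp_sub -!(homeo_exp_nat tau n) -!homeo_expD; apply: wy'; rewrite /L; lia.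
rewrite -!homeo_exp_sub -!(homeo_exp_natV tau n) -!homeo_expD; apply: wx'; rewrite /L; lia.
Qed.

Lemma mixing_SFT_mixing_product : conjugate_to_mixing_SFT tau ->
  mixing_product tau /\ expansive tau.
Proof.
move=> [A [S [[ftS mixS] [theta theta_tau]]]].
pose P := letter theta.
have PE i x : P (homeo_exp tau i x) = val (theta x) i := letter_exp theta_tau i x.
have cP : loc_const P := letter_const theta.
have gP : generating P tau := letter_generating theta_tau.
split; last first.
  have [d d_gt0 dP] := loc_const_uniform X_compact cP.
  exists d => // x y xy; apply: gP => i; exact: dP.
split.
  have [s sP] := finite_type_glue ftS.
  apply: (@glues_product_structure _ P s cP gP) => x y xy.
  have [|||c [Sc cy cx]] := sP (val (theta x)) (val (theta y)).
  - exact: set_valP.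
  - exact: set_valP.
  - case=> // j /andP[_ j_lt]; rewrite -!PE !homeo_exp_nat; exact: xy.
  have cS : c \in (S : set _) by rewrite inE.
  pose w := homeo_inv theta (exist _ c cS).
  have wE i : P (homeo_exp tau i w) = c i by rewrite PE /w homeo_invK.
  exists w => j.
    by rewrite -!homeo_exp_nat wE cy // PE.
  by rewrite -!homeo_exp_natV wE cx ?PE // oppr_le0.
pose theta' := Homeomorphism (homeo_invK theta) (homeo_funK theta)
  (@homeo_inv_continuous _ _ theta) (@homeo_fun_continuous _ _ theta).
apply: (mixing_conjugate (theta := theta')) mixS => a /=.
by apply: (can_inj (homeo_funK theta)); rewrite theta_tau !homeo_invK.
Qed.
End FromSFT.

Lemma fullshift_continuous (X : topologicalType) (A : finType) (f : X -> fullshift A) :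
  (forall i, loc_const (fun x => f x i : A)) -> continuous f.
Proof.
move=> cf x; apply/cvg_sup => i; apply/cvg_image.
  by apply/seteqP; split=> // a _; exists (fun=> a).
move=> W /= Wx; have {}Wx : W (f x i) by exact: nbhs_singleton Wx.
exists ((fun a : fullshift A => a i) @^-1` W).
  by apply: filterS (cf i x) => y /= ->.
by apply/seteqP; split=> [_ [a Wa <-]|a Wa] //; exists (fun=> a).
Qed.

Lemma subtype_continuous (X T : topologicalType) (S : set T) (f : X -> S) :
  continuous (fun x => val (f x)) -> continuous f.
Proof. by move=> cf; apply: continuous_comp_initial. Qed.

(** * From Markov partitions to SFTs *)

Section MarkovShift.
Variables (B : finType) (E : rel B).

Definition markov_set : set (fullshift B) := [set a | forall i : int, E (a i) (a (i + 1)%R)].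

Lemma markov_set_closed : closed markov_set.
Proof.
have -> : markov_set = \bigcap_(i in [set: int]) [set a | E (a i) (a (i + 1)%R)].
  by apply/seteqP; split=> a /= aE i; [move=> _|]; apply: aE.
apply: closed_bigI => i _; apply: loc_const_closed.
exact: (@loc_const_op _ B B Prop (fun b c => E b c) _ _
  (@coordinate_const B i) (@coordinate_const B (i + 1)%R)).
Qed.

Lemma markov_set_shift : @shift B @` markov_set = markov_set.
Proof.
apply/seteqP; split=> [_ [a aE <-] i|a aE]; first exact: aE.
exists (fun i => a (i - 1)%R); last by apply/funext => i; rewrite /shift addrK.
by move=> i; have := aE (i - 1)%R; rewrite subrK addrAC addrK.
Qed.

Definition markov_shift := Subshift markov_set_closed markov_set_shift.

Lemma markov_shift_finite_type : finite_type markov_shift.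
Proof.
exists [seq [:: p.1; p.2] | p <- enum {: B * B} & ~~ E p.1 p.2].
apply/seteqP; split=> [a aE w|a aN i].
  case/mapP => -[b c]; rewrite mem_filter /= => /andP[bc _] -> [i iw].
  move/negP: bc; apply; have := aE i.
  have := iw ord0; have := iw (Ordinal (isT : (1 < 2)%N)).
  by rewrite !(tnth_nth b) /= addr0 => -> ->.
apply: contrapT => /negP abN; apply: (aN [:: a i; a (i + 1)%R : B]).
  by apply/mapP; exists (a i, a (i + 1)%R) => //; rewrite mem_filter /= abN mem_enum.
exists i => -[[|[|//]] k_lt]; rewrite (tnth_nth (a i : B)) /= ?addr0 //.
Qed.
End MarkovShift.

Section ToSFT.
Variables (R : realType) (X : metricType R).
Hypothesis X_compact : compact [set: X].
Variable tau : homeo X.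

Section Coding.
Variables (B : finType) (kappa : X -> B).
Hypotheses (kappa_const : loc_const kappa) (kappa_markov : markov (kernel kappa) tau).
Hypothesis kappa_gen : generating kappa tau.

Definition transition : rel B :=
  fun b c => `[< exists x, kappa x = b /\ kappa (tau x) = c >].

Definition itinerary (x : X) : fullshift B := fun i => kappa (homeo_exp tau i x).

Lemma itinerary_markov x : itinerary x \in (markov_shift transition : set _).
Proof.
rewrite inE => i; apply/asboolP; exists (homeo_exp tau i x); split=> //.
by rewrite /itinerary homeo_expS.
Qed.

Definition coding (x : X) : markov_shift transition := exist _ (itinerary x) (itinerary_markov x).

(** A point chosen for every edge turns a path into a pseudo-orbit, which is traced. *)
Lemma coding_surj (a : markov_shift transition) : exists x, coding x = a.
Proof.
case: a => a aS; have /set_mem aE := aS.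
have [y yP] := choice (fun i => asboolW (aE i)).
have [i|x xy] := markov_trace X_compact kappa_const kappa_markov (y := y).
  by have [_ ->] := yP i; have [-> _] := yP (i + 1)%R.
exists x; apply: val_inj; apply/funext => i /=.
by rewrite /itinerary xy; have [] := yP i.
Qed.

Definition decoding (a : markov_shift transition) : X := projT1 (cid (coding_surj a)).

Lemma decodingK : cancel decoding coding.
Proof. by move=> a; exact: projT2 (cid (coding_surj a)). Qed.

Lemma coding_inj : injective coding.
Proof.
move=> x y /(congr1 val)/= xy; apply: kappa_gen => i.
exact: (congr1 (fun f => f i) xy).
Qed.

Lemma codingK : cancel coding decoding.
Proof. by move=> x; apply: coding_inj; rewrite decodingK. Qed.

Lemma coding_continuous : continuous coding.
Proof.
apply: subtype_continuous; apply: fullshift_continuous => i x.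
have [a [b [_ E]]] := homeo_exp_split tau i.
by apply: filterS (loc_const_orbit tau a b kappa_const x) => y; rewrite -!E.
Qed.

Lemma decoding_continuous : continuous decoding.
Proof.
move=> a W; rewrite -nbhs_ballE => -[e /= e_gt0 eW].
have [n nP] := generating_separates X_compact kappa_const kappa_gen e_gt0.
have near_a : \forall a' \near a, forall i, (i < n.*2.+1)%N ->
    val a' (i%:Z - n%:Z)%R = val a (i%:Z - n%:Z)%R :> B.
  have cst : loc_const (fun a' : markov_shift transition => forall i, (i < n.*2.+1)%N ->
      val a' (i%:Z - n%:Z)%R = val a (i%:Z - n%:Z)%R :> B).
    apply: loc_const_forall => i _.
    apply: (loc_const_map (fun b => b = val a (i%:Z - n%:Z)%R :> B)).
    exact: (loc_const_comp (@initial_continuous _ _ set_val)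
      (@coordinate_const B (i%:Z - n%:Z)%R)).
  by apply: filterS (cst a) => a' ->.
apply: (@filterS _ _ (nbhs_filter a) _ _ _ near_a) => a' a'a.
apply: eW; rewrite ballEmdist /=; apply: nP => i i_n.
have E b : kappa (homeo_exp tau (i%:Z - n%:Z)%R (decoding b)) = val b (i%:Z - n%:Z)%R.
  by rewrite -[b in RHS]decodingK.
by rewrite -!homeo_exp_sub !E a'a.
Qed.

Definition coding_homeo : homeomorphism X (markov_shift transition) :=
  Homeomorphism codingK decodingK coding_continuous decoding_continuous.

Lemma coding_tau x : coding (tau x) = sigma (coding x).
Proof.
apply: val_inj; apply/funext => i /=; rewrite /itinerary /shift /=.
by rewrite /itinerary homeo_expD.
Qed.

End Coding.

(** Fibres smaller than the expansive constant make [kappa] generating, so itineraries conjugate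
    [tau] to the shift on paths of the transition graph. *)
Lemma markov_basis_mixing_SFT : markov_basis tau -> expansive tau ->
  topologically_mixing tau -> conjugate_to_mixing_SFT tau.
Proof.
move=> mb [d d_gt0 dP] mix; have [B [kappa [ck fine mk]]] := mb d d_gt0.
have gk : generating kappa tau.
  by move=> x y xy; apply: dP => i; exact/ltW/fine.
exists B, (markov_shift (transition kappa)); split.
  split; first exact: markov_shift_finite_type.
  exact: (mixing_conjugate (theta := coding_homeo ck mk gk)) (coding_tau kappa) mix.
by exists (coding_homeo ck mk gk); exact: coding_tau.
Qed.
End ToSFT.

(** * Resolving textile systems *)

Lemma subshift_translate (B : finType) (Z : subshift B) (i : int) (z : fullshift B) :
  subshift_set Z z -> subshift_set Z (fun j => z (j + i)%R).
Proof.
have Zshift y : subshift_set Z y -> subshift_set Z (fun j => y (j + 1)%R).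
  by move=> Zy; rewrite -[subshift_set Z]subshift_shift; exists y.
have ZshiftV y : subshift_set Z y -> subshift_set Z (fun j => y (j - 1)%R).
  move=> Zy; have : (@shift B @` subshift_set Z) y by rewrite subshift_shift.
  case=> u Zu <-; suff -> : (fun j => shift u (j - 1)%R) = u by [].
  by apply/funext => j; rewrite /shift subrK.
have [n [->|->]] : exists n : nat, (i = n%:Z \/ i = - n%:Z)%R by exists `|i|%N; lia.
  elim: n z => [|n IH] z Zz.
    by suff -> : (fun j => z (j + 0%:Z)%R) = z by []; apply/funext => j; rewrite addr0.
  have := Zshift _ (IH z Zz); congr (subshift_set Z _).
  by apply/funext => j; congr z; lia.
elim: n z => [|n IH] z Zz.
  by suff -> : (fun j => z (j - 0%:Z)%R) = z by []; apply/funext => j; rewrite subr0.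
have := ZshiftV _ (IH z Zz); congr (subshift_set Z _).
by apply/funext => j; congr z; lia.
Qed.

(** The inverse of an injective letter-to-letter map has a finite window: counterexamples for all
    [N], translated to position [0], would accumulate at two distinct points with the same image. *)
Lemma letter_map_window (B A : finType) (Z : subshift B) (h : B -> A) :
  (forall z z', subshift_set Z z -> subshift_set Z z' ->
    (forall i : int, h (z i) = h (z' i)) -> z = z') ->
  exists N : nat, forall z z' (k : int), subshift_set Z z -> subshift_set Z z' ->
    (forall i : int, (- N%:Z <= i <= N%:Z)%R -> h (z (k + i)%R) = h (z' (k + i)%R)) ->
    z k = z' k :> B.
Proof.
move=> hinj; apply: contrapT => /forallNP noN.
pose C (n : nat) := [set zz : fullshift B * fullshift B |
  (forall j, (j < n.*2.+1)%N ->
     h (zz.1 (j%:Z - n%:Z)%R) = h (zz.2 (j%:Z - n%:Z)%R)) /\ zz.1 0%R <> zz.2 0%R :> B] `&`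
  [set zz | subshift_set Z zz.1] `&` [set zz | subshift_set Z zz.2].
have pairs_compact : compact [set: fullshift B * fullshift B].
  by rewrite -setXTT; apply: compact_setX; exact: fullshift_compact.
have [|||[z z'] zz'] := compact_nested pairs_compact (C := C).
- move=> n; apply: closedI; last first.
    by apply: closed_comp (@subshift_closed B Z) => zz _; exact: cvg_snd.
  apply: closedI; last first.
    by apply: closed_comp (@subshift_closed B Z) => zz _; exact: cvg_fst.
  apply: loc_const_closed; apply: loc_const_op.
    apply: loc_const_forall => j _.
    apply: (loc_const_pair (h := fun z : fullshift B => h (z (j%:Z - n%:Z)%R))).
    exact: (loc_const_map h (@coordinate_const B (j%:Z - n%:Z)%R)).
  apply: (loc_const_map not); exact: (loc_const_pair (@coordinate_const B 0%R)).
- move=> n [z z'] [[/= [zz z0] Zz] Zz']; split=> //; split=> //; split=> // j jn.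
  have := zz j.+1; have -> : (j.+1%:Z - n.+1%:Z = j%:Z - n%:Z)%R by lia.
  by apply; lia.
- move=> n; have /existsNP[z /existsNP[z' /existsNP[k]]] := noN n.
  move=> /not_implyP[Zz /not_implyP[Zz' /not_implyP[zz kk]]].
  exists (fun j => z (j + k)%R, fun j => z' (j + k)%R).
  split; [split|] => /=; [|exact: subshift_translate|exact: subshift_translate].
  by split=> [j jn|]; rewrite ?add0r // ![(_ + k)%R]addrC zz //; lia.
have [[[_ z0] Zz] Zz'] := zz' 0%N; apply: z0 => /=; rewrite (hinj z z') // => i.
have [[[/= + _] _] _] := zz' `|i|%N => /(_ (absz (i + `|i|%N%:Z)%R)).
have -> : ((absz (i + `|i|%N%:Z))%:Z - `|i|%N%:Z = i)%R by lia.
by apply; lia.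
Qed.

Section Textile.
Variables (X : topologicalType) (tau psi : homeo X).
Variables (A : finType) (S : subshift A) (f : S -> S) (theta : homeomorphism X S).
Hypothesis theta_tau : forall x, theta (tau x) = sigma (theta x).
Hypothesis theta_psi : forall x, theta (psi x) = f (theta x).
Variables (B : finType) (Gamma : graph B) (G : graph A) (p q : graph_hom Gamma G).
Variable Z : subshift B.
Hypothesis Z_path : Z `<=` path_space Gamma.
Hypothesis p_inj : set_inj Z (bipath_map p).
Hypothesis p_onto : bipath_map p @` Z = S.
Hypothesis f_pq : forall (a : S) (z : fullshift B),
  subshift_set Z z -> bipath_map p z = val a -> val (f a) = bipath_map q z.

Lemma textile_lift x : exists z, [/\ subshift_set Z z,
  forall i, hom_arc p (z i) = letter theta (homeo_exp tau i x) &
  forall i, hom_arc q (z i) = letter theta (homeo_exp tau i (psi x))].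
Proof.
have onto a : subshift_set S a -> (bipath_map p @` Z) a by rewrite p_onto.
have [z Zz zx] := onto _ (set_valP (theta x)); exists z; split=> // i.
  by rewrite (letter_exp theta_tau) -zx.
by rewrite (letter_exp theta_tau) theta_psi (f_pq Zz zx).
Qed.

(* The symbols [p (z i)], [0 <= i <= 2N], determine the arc [z N] by compactness, and
   then the arcs [z (N - 1), ..., z 0] because [p] is left-resolving. *)
Lemma left_resolving_anticipates : weakly_left_resolving p ->
  exists M, anticipates (letter theta) tau psi M.
Proof.
move=> res.
have [|N NP] := @letter_map_window _ _ Z (hom_arc p).
  by move=> z z' Zz Zz' zz'; apply: p_inj; rewrite ?inE //; exact/funext.
exists N.*2 => x y xy.
have [z [Zz zx zpx]] := textile_lift x; have [u [Zu uy upy]] := textile_lift y.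
have zu (i : nat) : (i < N.*2.+1)%N -> hom_arc p (z i) = hom_arc p (u i).
  by move=> i_lt; rewrite zx uy !homeo_exp_nat; exact: xy.
have agree_at (i : nat) : (i <= N)%N -> z (N - i)%N = u (N - i)%N.
  elim: i => [|i IH] i_le.
    rewrite subn0; apply: NP => // i iN.
    have -> : (N%:Z + i = (absz (N%:Z + i))%:Z)%R by lia.
    by apply: zu; lia.
  have Sk : ((N - i.+1)%N%:Z + 1 = (N - i)%N%:Z)%R by lia.
  apply: res; last by apply: zu; lia.
  have := Z_path Zz; have := Z_path Zu; rewrite /path_space /= => -> ->.
  by rewrite Sk IH // ltnW.
have := zpx 0%R; have := upy 0%R; rewrite !(homeo_exp_nat tau 0) /= => <- <-.
by have := agree_at N (leqnn N); rewrite subnn => ->.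
Qed.

(** The mirror image of the p-L case, reading [q] to the left. The induced map of [q] is injective
    on [Z] because [f] is conjugate to the homeomorphism [psi]. *)
Lemma right_resolving_anticipates : weakly_right_resolving q ->
  exists M, anticipates (letter theta) (homeo_inv tau) (homeo_inv psi) M.
Proof.
move=> res.
have [|N NP] := @letter_map_window _ _ Z (hom_arc q).
  move=> z z' Zz Zz' zz'; apply: p_inj; rewrite ?inE //.
  have in_S y : subshift_set Z y -> bipath_map p y \in (S : set _).
    by move=> Zy; rewrite inE -p_onto; exists y.
  pose a : S := exist _ (bipath_map p z) (in_S z Zz).
  pose a' : S := exist _ (bipath_map p z') (in_S z' Zz').
  suff : a = a' by move=> /(congr1 val).
  have f_inj : injective f.
    move=> b b'; rewrite -{1}(homeo_invK theta b) -{1}(homeo_invK theta b') -!theta_psi.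
    move=> /(can_inj (homeo_funK theta))/(can_inj (homeo_funK psi)).
    exact: can_inj (homeo_invK theta) _ _.
  apply: f_inj; apply: val_inj; rewrite (f_pq (z := z)) // (f_pq (z := z')) //.
  exact/funext.
exists N.*2 => x y xy.
have [z [Zz zx zpx]] := textile_lift (homeo_inv psi x).
have [u [Zu uy upy]] := textile_lift (homeo_inv psi y).
rewrite !homeo_invK in zpx upy.
have zu (i : nat) : (i < N.*2.+1)%N -> hom_arc q (z (- i%:Z)%R) = hom_arc q (u (- i%:Z)%R).
  by move=> i_lt; rewrite zpx upy !homeo_exp_natV; exact: xy.
have agree_at (i : nat) : (i <= N)%N -> z (- (N - i)%N%:Z)%R = u (- (N - i)%N%:Z)%R.
  elim: i => [|i IH] i_le.
    rewrite subn0; apply: NP => // i iN.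
    have -> : (- N%:Z + i = - (absz (- N%:Z + i))%:Z)%R by lia.
    by apply: zu; lia.
  have Sk : (- (N - i)%N%:Z + 1 = - (N - i.+1)%N%:Z)%R by lia.
  apply: res; last by apply: zu; lia.
  rewrite -Sk; have := Z_path Zz; have := Z_path Zu; rewrite /path_space /= => <- <-.
  by rewrite IH // ltnW.
have := zx 0%R; have := uy 0%R; rewrite !(homeo_exp_nat tau 0) /= => <- <-.
by have := agree_at N (leqnn N); rewrite subnn oppr0 => ->.
Qed.
End Textile.

(** * Extended districts *)

Section Districts.
Variables (R : realType) (X : metricType R).
Hypothesis X_compact : compact [set: X].
Implicit Types tau psi : homeo X.

Lemma pL_anticipating tau psi : essentially_weakly pL tau psi -> anticipating tau psi.
Proof.
move=> [/commute_fun com [A [S [f [theta [wf theta_tau theta_psi]]]]]].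
case: wf => _ _ [B [Gamma [G [p [q [Z [res [Z_path p_inj] p_onto _ f_pq]]]]]]].
split=> //.
have [M MP] := left_resolving_anticipates theta_tau theta_psi Z_path p_inj p_onto f_pq res.
exists A, (letter theta), M.
by split=> //; [exact: letter_const|exact: letter_generating].
Qed.

Lemma qR_anticipating tau psi : essentially_weakly qR tau psi ->
  anticipating (homeo_invg tau) (homeo_invg psi).
Proof.
move=> [/commute_fun com [A [S [f [theta [wf theta_tau theta_psi]]]]]].
case: wf => _ _ [B [Gamma [G [p [q [Z [res [Z_path p_inj] p_onto _ f_pq]]]]]]].
split.
  move=> x /=; rewrite (tauV_psiV (homeo_funK psi) (homeo_invK psi)
    (homeo_funK tau) (homeo_invK tau)) //.
have [M MP] := right_resolving_anticipates theta_tau theta_psi Z_path p_inj p_onto f_pq res.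
exists A, (letter theta), M; split=> //; first exact: letter_const.
exact/generating_inv/letter_generating.
Qed.

(** Both resolving conditions concern one textile system, so [psi] and its inverse satisfy the two
    anticipation conditions of [agree_markov] in the same coordinates. *)
Lemma LR_markov_basis tau psi : product_structure tau ->
  essentially_weakly LR tau psi -> markov_basis psi.
Proof.
move=> ps [/commute_fun com [A [S [f [theta [wf theta_tau theta_psi]]]]]].
case: wf => _ _ [B [Gamma [G [p [q [Z [[resp resq] [Z_path p_inj] p_onto _ f_pq]]]]]]].
have [M MP] := left_resolving_anticipates theta_tau theta_psi Z_path p_inj p_onto f_pq resp.
have [M' M'P] := right_resolving_anticipates theta_tau theta_psi Z_path p_inj p_onto f_pq resq.
pose P := letter theta.
have cP : loc_const P := letter_const theta.
have gP : generating P tau := letter_generating theta_tau.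
have [s sP] := product_structure_glues X_compact cP gP ps.
move=> e e_gt0; have [n nP] := generating_separates X_compact cP gP e_gt0.
have tau_psi x : tau (psi x) = psi (tau x) by rewrite com.
pose k := (n.*2.+1 + s)%N.
have mk : markov (agree P tau k) psi.
  apply: (agree_markov (homeo_funK tau) (homeo_invK tau) (homeo_funK psi) (homeo_invK psi)
    tau_psi MP M'P sP); exact: leq_addl.
exists {ffun 'I_k -> A}, (block P tau k \o iter n (homeo_inv tau)); split.
- exact: loc_const_comp (@iter_homeoV_continuous _ _ tau n) (loc_const_block tau k cP).
- move=> x y /blockP xy; apply: nP => j jn; apply: xy.
  by rewrite (leq_trans jn) // leq_addr.
move=> y py m.
have [i|w wP] := mk (fun i => iter n (homeo_inv tau) (y i)) _ m.
  apply/blockP; have := py i; rewrite /kernel /= => <-; congr block.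
  exact/esym/(iter_tau_psi (tauV_psi (homeo_funK tau) (homeo_invK tau) tau_psi) n 1).
exists (iter n tau w) => i i_m; rewrite /kernel /= (psi_iter_conj tau_psi).
exact/blockP/wP.
Qed.

Lemma resolving_markov tau psi : mixing_product tau ->
  essentially_weakly pL tau psi /\ left_expansive tau psi \/
  essentially_weakly qR tau psi /\ right_expansive tau psi ->
  markov_basis psi /\ topologically_mixing psi.
Proof.
move=> mp [[/pL_anticipating ant le]|[/qR_anticipating ant /left_expansive_inv le]].
  exact: one_sided_expansive_markov ant le.
have [mb mix] := one_sided_expansive_markov X_compact (mixing_product_inv mp) ant le.
by split; [exact: markov_basis_inv|exact: mixing_inv mix].
Qed.

Lemma expansive_right tau psi : expansive psi -> right_expansive tau psi.
Proof.
by move=> [d d_gt0 dP]; exists d => // x y xy; apply: dP => i; exact: (xy i 0%R).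
Qed.

Lemma resolves_markov tau psi : mixing_product tau -> resolves psi tau -> expansive psi ->
  markov_basis psi /\ topologically_mixing psi.
Proof.
move=> mp [_ [pq|pq]] epsi; apply: resolving_markov mp _.
  by left; split=> //; exact: expansive_left.
by right; split=> //; exact: expansive_right.
Qed.

(** The converse direction exchanges the roles by [anticipating_dual] and uses that [tau] is
    expansive; in the q-R case both maps are inverted first. *)
Lemma resolves_mixing_product tau psi : resolves psi tau -> expansive psi ->
  mixing_product tau <-> mixing_product psi.
Proof.
move=> res epsi; split=> [mp|mp].
  have [mb mix] := resolves_markov mp res epsi.
  by split=> //; exact: markov_basis_product.
have [etau] := res.
have dual (f g : homeo X) : mixing_product f -> anticipating g f -> expansive f -> expansive g ->
    mixing_product (homeo_invg g).
  move=> mf ant ef eg.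
  have [mb mix] := one_sided_expansive_markov X_compact (mixing_product_inv mf)
    (anticipating_dual X_compact ant ef) (expansive_left _ (expansive_inv eg)).
  by split=> //; exact: markov_basis_product.
have invK (f : homeo X) : homeo_invg (homeo_invg f) = f by apply: homeo_ext.
case=> [/pL_anticipating|/qR_anticipating] ant.
  by rewrite -[tau]invK; apply: mixing_product_inv; exact: dual ant _ _.
rewrite -[tau]invK; apply: (dual (homeo_invg psi)) => //.
- exact: mixing_product_inv.
- exact: expansive_inv.
- exact: expansive_inv.
Qed.

Lemma district_mixing_product (K : set (homeo X)) tau psi :
  extended_district_of K tau psi -> expansive psi ->
  mixing_product tau <-> mixing_product psi.
Proof.
move=> [_ [r [t [r_gt0 tK psi_t tt <-]]]] epsi.
rewrite -(resolves_mixing_product psi_t epsi).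
have chain i : (1 <= i <= r)%N -> mixing_product (t i) <-> mixing_product (t 1%N).
  elim: i => [|[|i] IH] // /andP[_ i_le].
  rewrite -IH ?(ltnW i_le) //; apply: resolves_mixing_product; first exact: tt.
  by have [] := tK i.+1 (ltnW i_le).
by apply: chain; rewrite r_gt0 leqnn.
Qed.
End Districts.

Theorem theorem10p5 (R : realType) (X : metricType R)
    (X_compact : compact [set: X]) (X_zero_dimensional : zero_dimensional X)
    (K : set (homeo X)) (K_subgroup : group_closed (mem K))
    (D : set (homeo X)) (D_district : extended_district K D)
    (D_mixing_SFT : exists2 tau : homeo X, D tau & conjugate_to_mixing_SFT tau)
    (phi : homeo X) (D_phi : D phi) (phi_expansive : expansive phi) :
  [/\ conjugate_to_mixing_SFT phi,
      (forall psi : homeo X,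
         (PL K phi psi /\ left_expansive phi psi) \/
         (QR K phi psi /\ right_expansive phi psi) ->
         POTP psi /\ topologically_mixing psi) &
      (forall psi : homeo X, CLR K phi psi -> POTP psi)].
Proof.
have [tau0 [Ktau0 etau0 DE]] := D_district.
have [tau Dtau /(mixing_SFT_mixing_product X_compact)[mtau etau]] := D_mixing_SFT.
rewrite DE in Dtau D_phi.
have mtau0 : mixing_product tau0 by apply/(district_mixing_product X_compact Dtau etau).
have mphi : mixing_product phi by apply/(district_mixing_product X_compact D_phi phi_expansive).
split=> [|psi psi_res|psi [_ psi_LR]].
(* Markov partitions for [phi] come from the first link [t 1], which inherits the mixing product
   structure from [phi]. *)
- have [_ [r [t [r_gt0 tK phi_t _ _]]]] := D_phi.
  have [_ et] := tK 1%N r_gt0.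
  have mt : mixing_product (t 1%N) by apply/(resolves_mixing_product X_compact phi_t phi_expansive).
  have [mb mix] := resolves_markov X_compact mt phi_t phi_expansive.
  exact: markov_basis_mixing_SFT.
- have [|mb mix] := resolving_markov X_compact mphi (psi := psi).
    by case: psi_res => -[[_ ?] ?]; [left|right].
  by split=> //; exact: markov_basis_potp.
- by apply: markov_basis_potp => //; exact: LR_markov_basis mphi.1 psi_LR.
Qed.
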